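(* Let $c=1/300$, $\Delta_1,L,\sigma>0$, $p\in(1,2]$, and $0<\varepsilon\le c\min\{\sigma,\sqrt{\Delta_1L}\}$. Then for all integers $m,n\ge2$ with $$\max\{m,n\}\ \ge\ \min\{m,n\}\,\frac{\Delta_1L}{\varepsilon^2}$$ we have $$\mathfrak m^{\mathrm{zr}}_\varepsilon\big(\|\cdot\|_{S_1},\Delta_1,L,p,\sigma\big)\ \ge\ c^2\,\min\{m,n\}\cdot\frac{\Delta_1L}{\varepsilon^2}\Big(\frac{c\,\sigma}{\varepsilon}\Big)^{\frac{p}{p-1}} .$$
   Context: $\|\cdot\|_{S_1}$ is the nuclear norm, $\|\cdot\|_{S_\infty}$ the spectral norm on $\mathbb R^{m\times n}$. Function class: $\mathcal F_{\Delta_1,L}(m,n)$ is the set of differentiable $F:\mathbb R^{m\times n}\to\mathbb R$ with $\|\nabla F(x)-\nabla F(y)\|_{S_1}\le L\|x-y\|_{S_\infty}$ for all $x,y$ and $F(0)-\inf_xF(x)\le\Delta_1$. Oracle class: $\mathcal O_{p,\sigma}$ is the class of stochastic first-order oracles $O$, where $O$ supplies for each $F\in\mathcal F_{\Delta_1,L}(m,n)$ a stochastic gradient $\nabla f(x,\xi)$ with $\mathbb E[\nabla f(x,\xi)]=\nabla F(x)$ and $\mathbb E[\|\nabla f(x,\xi)-\nabla F(x)\|_{S_1}^p]\le\sigma^p$ for all $x$; successive queries use independent copies $\xi_1,\xi_2,\dots$ of $\xi$. Algorithms: a possibly randomised first-order algorithm, given the starting point $0$ and a random seed $r$ independent of everything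 else, produces iterates $x_1,x_2,\dots$, observes $g_t=\nabla f(x_t,\xi_t)$, and $x_{t+1}$ is a measurable function of $r,g_1,\dots,g_t$. It is zero-respecting if $x_1=0$ and $\mathrm{supp}(x_{t+1})\subseteq\bigcup_{\tau=1}^t\mathrm{supp}(g_\tau)$ for all $t\ge1$, where $\mathrm{supp}$ is the set of indices of nonzero matrix entries. $\mathcal A_{\mathrm{zr}}$ is the class of such zero-respecting algorithms. Complexity: $$\mathfrak m^{\mathrm{zr}}_\varepsilon(\|\cdot\|_{S_1},\Delta_1,L,p,\sigma)=\sup_{O\in\mathcal O_{p,\sigma}}\ \sup_{P_F\in\mathcal P[\mathcal F_{\Delta_1,L}(m,n)]}\ \inf_{A\in\mathcal A_{\mathrm{zr}}}\ \inf\{T\in\mathbb N:\ \mathbb E[\|\nabla F(x_T)\|_{S_1}]\le\varepsilon\},$$ where $\mathcal P[\cdot]$ denotes the set of all probability distributions on the class, $F\sim P_F$ is drawn independently of $r$ and the $\xi_t$, the expectation is over $F$, $r$ and $(\xi_t)$, and $\inf\emptyset=+\infty$. *)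

(* Defs.v *)
From HB Require Import structures.
From mathcomp Require Import all_boot all_order all_algebra.
From mathcomp Require Import spectral complex.
From mathcomp Require Import all_classical all_reals all_analysis.

Set Implicit Arguments.
Unset Strict Implicit.
Unset Printing Implicit Defensive.

Import Order.TTheory GRing.Theory Num.Theory.
Import numFieldNormedType.Exports.

Local Open Scope classical_set_scope.
Local Open Scope ring_scope.

Section SchattenNorms.
Variables (R : realType) (m n : nat).
Implicit Type A : 'M[R]_(m, n).

(* The square roots of the eigenvalues, with multiplicity, of the symmetric
   matrix A^T A, diagonalised over R[i]. When m < n this lists n - m further
   zeros, which do not affect the norms below. *)
Definition singular_values A : 'rV[R]_n :=
  \row_j Num.sqrt
    (complex.Re (spectral_diag (map_mx (real_complex R) (A^T *m A)) 0 j)).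

Definition nuclear_norm A : R := \sum_(j < n) singular_values A 0 j.

Definition spectral_norm A : R :=
  \big[Num.max/0]_(j < n) singular_values A 0 j.

Lemma singular_values0 : singular_values (0 : 'M[R]_(m, n)) = 0.
Proof.
apply/rowP => j; rewrite !mxE mulmx0 map_mx0.
have /orthomx_spectralP E : (0 : 'M[R[i]]_n) \is normalmx.
  by apply/normalmxP; rewrite mul0mx mulmx0.
set P := spectralmx _ in E; have U : P \in unitmx by exact: spectral_unit.
move: E => /(congr1 (mulmx P)).
rewrite mulmx0 !mulmxA mulmxV// mul1mx => /(congr1 (mulmxr (invmx P))).
rewrite /= mul0mx mulmxK// => /matrixP/(_ j j).
by rewrite !mxE eqxx mulr1n => <-; rewrite sqrtr0.
Qed.

Lemma nuclear_norm0 : nuclear_norm 0 = 0.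
Proof.
by rewrite /nuclear_norm singular_values0 big1// => j _; rewrite mxE.
Qed.

Lemma spectral_norm_ge0 A : 0 <= spectral_norm A.
Proof.
rewrite /spectral_norm; elim/big_ind: _ => // [x y|j _].
  by rewrite le_max => ->.
by rewrite mxE sqrtr_ge0.
Qed.

End SchattenNorms.

Section MatrixMeasurable.
Variables (R : realType) (m n : nat).

(* The product sigma-algebra of R^(m x n), i.e. the Borel one. *)
Definition matrix_cylinders : set (set 'M[R]_(m, n)) :=
  \bigcup_(ij in [set: 'I_m * 'I_n])
    preimage_set_system setT (fun A : 'M[R]_(m, n) => A ij.1 ij.2) measurable.

HB.instance Definition _ :=
  Measurable.copy 'M[R]_(m, n) (g_sigma_algebraType matrix_cylinders).

End MatrixMeasurable.

Definition gradient (R : realType) (m n : nat) (F : 'M[R]_(m, n) -> R)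
    (x : 'M[R]_(m, n)) : 'M[R]_(m, n) :=
  \matrix_(i, j) 'D_(delta_mx i j) F x.

(* Positivity of Delta1 and L makes the class inhabited (by 0), as a
   measurableType has to be. *)
Section Objectives.
Variables (R : realType) (m n : nat) (Delta1 L : {posnum R}).
Implicit Type F : 'M[R]_(m, n) -> R.

Definition in_objective_class F : Prop :=
  [/\ forall x, differentiable F x,
      forall x y, nuclear_norm (gradient F x - gradient F y) <=
                  L%:num * spectral_norm (x - y) &
      ((F 0)%:E - ereal_inf (range (fun x => (F x)%:E)) <= Delta1%:num%:E)%E].

Record objective := Objective {
  objective_fun :> 'M[R]_(m, n) -> R ;
  objective_in_class : in_objective_class objective_fun }.

Lemma zero_in_objective_class : in_objective_class (fun=> 0).
Proof.
split=> [x|x y|]; first exact: differentiable_cst.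
- rewrite [X in nuclear_norm X](_ : _ = 0) ?nuclear_norm0.
    by rewrite mulr_ge0 ?spectral_norm_ge0.
  by apply/matrixP => i j; rewrite !mxE !derive_cst subr0.
- rewrite (_ : range _ = [set 0%E]); last first.
    by apply/seteqP; split=> [_ [x _ <-]|_ ->] //=; exists 0.
  by rewrite ereal_inf1 sube0 lee_fin.
Qed.

HB.instance Definition _ := gen_eqMixin objective.
HB.instance Definition _ := gen_choiceMixin objective.
HB.instance Definition _ :=
  isPointed.Build objective (Objective zero_in_objective_class).

(* Distributions on the class live on the sigma-algebra generated by the
   evaluations F |-> F x. *)
Definition objective_cylinders : set (set objective) :=
  \bigcup_(x in [set: 'M[R]_(m, n)])
    preimage_set_system setT (fun F : objective => F x) measurable.

HB.instance Definition _ :=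
  Measurable.copy objective (g_sigma_algebraType objective_cylinders).

End Objectives.

Section Sampling.
Context {R : realType} {d : measure_display} {T : measurableType d}.
Variable P : probability T R.

Definition cons_pair k (z : T * k.-tuple T) : k.+1.-tuple T :=
  [tuple of z.1 :: z.2].

Lemma measurable_cons_pair k : measurable_fun setT (@cons_pair k).
Proof. exact: (measurable_cons measurable_fst measurable_snd). Qed.

HB.instance Definition _ k := isMeasurableFun.Build _ _ _ _
  (@cons_pair k) (@measurable_cons_pair k).

(* The law of k independent samples of P. *)
Fixpoint iid_law k : probability (k.-tuple T) R :=
  if k is k'.+1 then distribution (P \x iid_law k')%E (@cons_pair k')
  else dirac [tuple].

End Sampling.

Section Complexity.
Variables (R : realType) (m n : nat).
Local Notation M := 'M[R]_(m, n).

(* A stochastic gradient is jointly measurable in the objective, the query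
   and the noise, so that the expectation over F, r and (xi_t) makes sense. *)
Record oracle (Delta1 L : {posnum R}) (p sigma : R) := Oracle {
  noise_display : measure_display ;
  noise_space : measurableType noise_display ;
  noise_law : probability noise_space R ;
  stoch_grad : objective m n Delta1 L -> M -> noise_space -> M ;
  measurable_stoch_grad : measurable_fun setT
    (fun w : objective m n Delta1 L * (M * noise_space) =>
       stoch_grad w.1 w.2.1 w.2.2) ;
  stoch_grad_integrable : forall F x i j,
    noise_law.-integrable setT (fun xi => (stoch_grad F x xi i j)%:E) ;
  stoch_grad_unbiased : forall F x i j,
    (\int[noise_law]_xi (stoch_grad F x xi i j)%:E = (gradient F x i j)%:E)%E ;
  stoch_grad_moment : forall F x,
    (\int[noise_law]_xi
       (nuclear_norm (stoch_grad F x xi - gradient F x) `^ p)%:E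
     <= (sigma `^ p)%:E)%E }.

(* next_iterate r [:: g_1; ...; g_t] is the iterate x_(t+1). *)
Record algorithm := Algorithm {
  seed_display : measure_display ;
  seed_space : measurableType seed_display ;
  seed_law : probability seed_space R ;
  next_iterate : seed_space -> seq M -> M ;
  measurable_next_iterate : forall t, measurable_fun setT
    (fun w : seed_space * t.-tuple M => next_iterate w.1 w.2) }.

Definition mxsupp (A : M) : {set 'I_m * 'I_n} := [set ij | A ij.1 ij.2 != 0].

Definition zero_respecting (A : algorithm) : Prop :=
  (forall r : seed_space A, next_iterate r [::] = 0) /\
  (forall (r : seed_space A) (gs : seq M), (0 < size gs)%N ->
     mxsupp (next_iterate r gs) \subset \bigcup_(g <- gs) mxsupp g).

Section Run.
Variables (Delta1 L : {posnum R}) (p sigma : R).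
Variables (O : oracle Delta1 L p sigma) (A : algorithm).
Implicit Types (F : objective m n Delta1 L) (r : seed_space A).

(* The answers g_1, ..., g_t to the first t queries, the noises being
   xi_1, ..., xi_t. *)
Definition answers F r (xis : seq (noise_space O)) : seq M :=
  foldl (fun gs xi => rcons gs (stoch_grad F (next_iterate r gs) xi))
    [::] xis.

(* E [ || grad F(x_(t+1)) ||_S1 ]; the iterate x_(t+1) depends on the noises
   xi_1, ..., xi_t only. *)
Definition expected_gradient_norm
    (PF : probability (objective m n Delta1 L) R) (t : nat) : \bar R :=
  (\int[PF \x (seed_law A \x iid_law (noise_law O) t)]_w
     (nuclear_norm
        (gradient w.1 (next_iterate w.2.1 (answers w.1 w.2.1 w.2.2))))%:E)%E.

End Run.

(* The inner set is the set of T >= 1 with E [ || grad F(x_T) ||_S1 ] <= eps.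
   The oracles and the algorithms range over types too large for the notation
   [set E | x in A]. *)
Definition zr_complexity (eps : R) (Delta1 L : {posnum R}) (p sigma : R) :
    \bar R :=
  ereal_sup [set s | exists O : oracle Delta1 L p sigma, s =
    ereal_sup [set v | exists PF : probability (objective m n Delta1 L) R, v =
      ereal_inf [set u | exists A : algorithm, zero_respecting A /\ u =
        ereal_inf [set t.+1%:R%:E | t in
          [set t | (expected_gradient_norm O A PF t <= eps%:E)%E]]]]].

End Complexity.

(* Main.v *)
Require Import Defs.
From HB Require Import structures.
From mathcomp Require Import all_boot all_order all_algebra.
From mathcomp Require Import spectral complex.
From mathcomp Require Import all_classical all_reals all_analysis.
From mathcomp Require Import measurable_realfun ring lra zify.

Set Implicit Arguments.
Unset Strict Implicit.
Unset Printing Implicit Defensive.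

Import Order.TTheory GRing.Theory Num.Theory.
Import numFieldNormedType.Exports.

Local Open Scope ring_scope.

(** A single objective and a single oracle defeat all zero-respecting algorithms,
    so the distribution of the objective can be a Dirac mass.

    The objective is a sum of k = min(m, n) chains of d variables, with d of the
    order of Delta1 L / eps^2. Chain i occupies row i (column i of a tall
    matrix), in columns (rows) of its own; this is where max(m, n) has to be
    large. On matrices supported there, the nuclear norm is the sum of the
    Euclidean norms of the chains, while the spectral norm of every matrix is at
    least each of these (chain_layout). Hence a sum of k functions that are
    L / k-smooth in the Euclidean sense is L-smooth from the spectral to the
    nuclear norm, and each chain works with the fractions Delta1 / k, L / k and
    eps / k of the budget, which allow for the same length as for k = 1.

    A chain is a sum of terms - step(y_j) ramp(y_(j+1)), plus a penalty for
    negative variables. A variable has zero partial derivative as long as it and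
    its predecessor vanish (partial_zero), but as long as the last variable
    vanishes, some partial derivative is at least 1 in absolute value
    (unfinished_partial): all terms of a partial derivative have the same sign,
    and at the first variable below 1 two of them suffice.

    A zero-respecting algorithm can only change a variable after having seen a
    nonzero derivative for it. The oracle draws each chain with probability
    q / k, reveals the next derivative of that chain multiplied by k / q, and
    hides the next derivatives of all other chains. The moment condition allows
    for q of the order of (eps / sigma)^(p/(p-1)). Now chain i advances at most
    as often as it is drawn, whatever the algorithm does (run_zero). After t
    queries the mean number of successful draws is t q, so by Markov's inequality
    (few_reveals) at least half of the chains are unfinished with probability at
    least 1 - 2 t q / (k d); each of them contributes 4 eps / k to the nuclear
    norm of the gradient (expected_gradient_norm_ge). An expected norm of at
    most eps therefore needs t >= k d / (4 q).

    The noise is the same for all objectives and is added to their exact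
    gradients; the oracle is then jointly measurable because (F, x) |-> grad F x
    is, by approximation of x on finer and finer grids (measurable_gradient). *)

(** * Singular values *)

(** Both sides are determinants of products of the block matrix Z below with a
    block triangular matrix. *)
Lemma char_poly_mulC (K : comNzRingType) m n (A : 'M[K]_(m, n)) (B : 'M[K]_(n, m)) :
  'X ^+ n * char_poly (A *m B) = 'X ^+ m * char_poly (B *m A).
Proof.
rewrite /char_poly /char_poly_mx !map_mxM.
set A' := map_mx _ A; set B' := map_mx _ B.
pose Z := block_mx ('X%:M : 'M[{poly K}]_m) A' B' (1%:M : 'M[{poly K}]_n).
have <- : \det Z = \det ('X%:M - A' *m B').
  rewrite -[LHS]mulr1 -[X in _ * X](_ : \det (block_mx 1%:M 0 (- B') 1%:M) = _).
    rewrite -det_mulmx mulmx_block !mulmx1 !mulmx0 !add0r mul1mx mulmxN subrr.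
    by rewrite det_ublock det1 mulr1.
  by rewrite det_lblock !det1 mulr1.
have -> : 'X ^+ n = \det (block_mx (1%:M : 'M[{poly K}]_m) 0 (- B') ('X%:M : 'M[{poly K}]_n)).
  by rewrite det_lblock det1 det_scalar mul1r.
rewrite -det_mulmx mulmx_block !mul1mx !mul0mx !addr0 mulmx1.
rewrite mulNmx mul_mx_scalar mul_scalar_mx addNr mulNmx addrC.
by rewrite det_ublock det_scalar.
Qed.

Lemma char_poly_conj (K : fieldType) n (P A : 'M[K]_n) : P \in unitmx ->
  char_poly (invmx P *m A *m P) = char_poly A.
Proof.
move=> UP; have := @char_poly_mulC _ n n (invmx P *m A) P.
rewrite mulmxA mulmxV// mul1mx => /mulfI; apply.
by rewrite expf_neq0// polyX_eq0.
Qed.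

Lemma char_poly_diag (K : comNzRingType) n (s : 'rV[K]_n) :
  char_poly (diag_mx s) = \prod_(j < n) ('X - (s 0 j)%:P).
Proof.
rewrite char_poly_trig ?diag_mx_is_trig//.
by apply: eq_bigr => j _; rewrite mxE eqxx mulr1n.
Qed.

Section SchattenNormBounds.
Context {R : realType}.
Local Notation cmx A := (map_mx (real_complex R) A).

Lemma gram_hermsymmx m n (A : 'M[R]_(m, n)) : cmx (A^T *m A) \is hermsymmx.
Proof.
apply: realsym_hermsym.
  by apply/is_hermitianmxP; rewrite expr0 scale1r map_mx_id// map_trmx trmx_mul trmxK.
by apply/mxOverP => i j; rewrite mxE; apply/complex_realP; eexists.
Qed.

Lemma char_poly_gram m n (A : 'M[R]_(m, n)) :
  char_poly (cmx (A^T *m A)) =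
  \prod_(j < n) ('X - (spectral_diag (cmx (A^T *m A)) 0 j)%:P).
Proof.
have /orthomx_spectralP := hermitian_normalmx (gram_hermsymmx A).
set P := spectralmx _; set s := spectral_diag _ => {1}->.
have UP : P \in unitmx by exact: spectral_unit.
by rewrite char_poly_conj// char_poly_diag.
Qed.

(** Characteristic polynomials that agree up to powers of 'X have the same roots
    up to zeros, and zeros do not contribute to the sum. This lets A A^T replace
    A^T A. *)
Lemma nuclear_norm_char_poly m n (A : 'M[R]_(m, n)) k a b (s : 'I_k -> R) :
  'X ^+ a * char_poly (cmx (A^T *m A)) =
    'X ^+ b * \prod_(i < k) ('X - (real_complex R (s i))%:P) ->
  nuclear_norm A = \sum_(i < k) Num.sqrt (s i).
Proof.
rewrite char_poly_gram => eqp.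
pose d := [seq spectral_diag (cmx (A^T *m A)) 0 j | j <- index_enum 'I_n].
pose e := [seq real_complex R (s j) | j <- index_enum 'I_k].
have Xn c : 'X ^+ c = \prod_(z <- nseq c (0 : R[i])) ('X - z%:P).
  by rewrite big_nseq subr0 iter_mulr_1.
have /prod_XsubC_eq pe : \prod_(z <- nseq a 0 ++ d) ('X - z%:P) =
    \prod_(z <- nseq b 0 ++ e) ('X - z%:P).
  by rewrite !big_cat -!Xn /d /e !big_map.
have := perm_big _ pe (op := +%R) (P := xpredT)
  (F := fun z => Num.sqrt (complex.Re z)) (x := 0).
rewrite !big_cat /= !big_nseq /= sqrtr0 !iter_addr_0 !mul0rn !add0r /d /e !big_map.
move=> <-.
by apply: eq_bigr => j _; rewrite mxE.
Qed.

Lemma nuclear_norm_col_orthogonal m n (A : 'M[R]_(m, n)) (s : 'rV_n) :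
  A^T *m A = diag_mx s -> nuclear_norm A = \sum_j Num.sqrt (s 0 j).
Proof.
move=> AA; apply: (@nuclear_norm_char_poly _ _ _ _ 0 0).
rewrite AA map_diag_mx char_poly_diag; congr (_ * _).
by apply: eq_bigr => j _; rewrite mxE.
Qed.

Lemma nuclear_norm_row_orthogonal m n (A : 'M[R]_(m, n)) (s : 'rV_m) :
  A *m A^T = diag_mx s -> nuclear_norm A = \sum_i Num.sqrt (s 0 i).
Proof.
move=> AA; apply: (@nuclear_norm_char_poly _ _ _ _ m n).
rewrite map_mxM -char_poly_mulC -map_mxM AA map_diag_mx char_poly_diag.
by congr (_ * _); apply: eq_bigr => j _; rewrite mxE.
Qed.

Lemma nuclear_norm_ge0 m n (A : 'M[R]_(m, n)) : 0 <= nuclear_norm A.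
Proof. by apply: sumr_ge0 => j _; rewrite mxE sqrtr_ge0. Qed.

Lemma singular_value_le_spectral_norm m n (A : 'M[R]_(m, n)) j :
  singular_values A 0 j <= spectral_norm A.
Proof.
by rewrite /spectral_norm; apply: (le_bigmax _ (fun j => singular_values A 0 j)).
Qed.

(** Diagonalising A^T A by a unitary P, |A v|^2 is the sum of the eigenvalues
    weighted by the squared moduli of the coordinates of P v. *)
Lemma sqr_mulmx_le_spectral_norm m n (A : 'M[R]_(m, n)) (v : 'cV[R]_n) :
  \sum_i (A *m v) i 0 ^+ 2 <= spectral_norm A ^+ 2 * \sum_j v j 0 ^+ 2.
Proof.
have sumsq l (w : 'cV[R]_l) : \sum_i w i 0 ^+ 2 = (w^T *m w) 0 0.
  by rewrite mxE; apply: eq_bigr => i _; rewrite mxE expr2.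
have /orthomx_spectralP := hermitian_normalmx (gram_hermsymmx A).
set P := spectralmx _; set s := spectral_diag _ => AA.
have UP : P \is unitarymx by exact: spectral_unitarymx.
pose w := P *m cmx v.
have wE : (cmx v)^T *m invmx P = map_mx Num.conj w^T.
  rewrite invmx_unitary// /w trmx_mul map_mxM map_trmx; congr (_ *m _).
  apply/matrixP => i j; rewrite !mxE; apply/esym/CrealP.
  by apply/complex_realP; eexists.
have wK : invmx P *m w = cmx v by rewrite mulKmx// unitarymx_unit.
clearbody w.
have quad (t : 'rV[R[i]]_n) : (((cmx v)^T *m (invmx P *m diag_mx t *m P) *m cmx v) 0 0) =
   \sum_j t 0 j * (`|w j 0| ^+ 2).
  rewrite !mulmxA wE -!mulmxA [P *m _](_ : _ = w) ?mulmxA ?mxE; last first.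
    by rewrite -wK mulKVmx// unitarymx_unit.
  apply: eq_bigr => j _.
  by rewrite mul_mx_diag !mxE normCK mulrAC mulrC [_^* * _]mulrC.
have s_real j : s 0 j \is Num.real.
  apply/mxOverP: 0 j; apply: hermitian_spectral_diag_real.
  exact: gram_hermsymmx.
have re_sq j : `|w j 0| ^+ 2 = (complex.Re (w j 0) ^+ 2 + complex.Im (w j 0) ^+ 2)%:C%C.
  by rewrite add_Re2_Im2.
have E1 : \sum_i (A *m v) i 0 ^+ 2 =
   \sum_j complex.Re (s 0 j) * (complex.Re (w j 0) ^+ 2 + complex.Im (w j 0) ^+ 2).
  rewrite sumsq; apply: (@complexI R).
  transitivity ((cmx ((A *m v)^T *m (A *m v))) 0 0); first by rewrite [RHS]mxE.
  rewrite trmx_mul mulmxA -[v^T *m _ *m _]mulmxA !map_mxM -(map_trmx _ v) -map_mxM AA quad.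
  rewrite rmorph_sum; apply: eq_bigr => j _.
  by rewrite rmorphM /= RRe_real -?re_sq//; exact: s_real.
have E2 : \sum_j v j 0 ^+ 2 =
   \sum_j (complex.Re (w j 0) ^+ 2 + complex.Im (w j 0) ^+ 2).
  rewrite sumsq; apply: (@complexI R).
  transitivity ((cmx (v^T *m v)) 0 0); first by rewrite [RHS]mxE.
  rewrite map_mxM -map_trmx -[X in _ *m X]wK mulmxA wE mxE rmorph_sum; apply: eq_bigr => j _.
  by rewrite !mxE /= -re_sq normCK mulrC.
rewrite E1 E2 mulr_sumr; apply: ler_sum => j _.
rewrite ler_wpM2r ?addr_ge0 ?sqr_ge0//.
have [s0|/ltW s0] := leP (complex.Re (s 0 j)) 0.
  by rewrite (le_trans s0)// sqr_ge0.
rewrite -[leLHS]sqr_sqrtr// ler_sqr ?nnegrE ?sqrtr_ge0 ?spectral_norm_ge0//.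
by have := singular_value_le_spectral_norm A j; rewrite mxE.
Qed.

(** Test A against a basis vector. *)
Lemma col_le_spectral_norm m n (A : 'M[R]_(m, n)) j :
  Num.sqrt (\sum_i A i j ^+ 2) <= spectral_norm A.
Proof.
rewrite -[leRHS]ger0_norm ?spectral_norm_ge0// -sqrtr_sqr ler_wsqrtr//.
have := sqr_mulmx_le_spectral_norm A (delta_mx j 0).
rewrite [X in _ * X](bigD1 j)//= [X in _ + X]big1 => [|l /negPf lj]; last first.
  by rewrite mxE lj expr0n.
rewrite mxE !eqxx expr1n addr0 mulr1; apply: le_trans.
by apply: ler_sum => i _; rewrite -colE mxE.
Qed.

(** Test A against the row itself. *)
Lemma row_le_spectral_norm m n (A : 'M[R]_(m, n)) i :
  Num.sqrt (\sum_j A i j ^+ 2) <= spectral_norm A.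
Proof.
rewrite -[leRHS]ger0_norm ?spectral_norm_ge0// -sqrtr_sqr ler_wsqrtr//.
set S := \sum_j _; have S0 : 0 <= S by apply: sumr_ge0 => j _; exact: sqr_ge0.
have := sqr_mulmx_le_spectral_norm A (row i A)^T.
have -> : \sum_j (row i A)^T j 0 ^+ 2 = S by apply: eq_bigr => j _; rewrite !mxE.
have : S ^+ 2 <= \sum_l (A *m (row i A)^T) l 0 ^+ 2.
  rewrite (bigD1 i)//= ler_wpDr//; first by apply: sumr_ge0 => l _; exact: sqr_ge0.
  rewrite mxE (eq_bigr (fun j => A i j ^+ 2)) // => j _.
  by rewrite !mxE expr2.
move=> /le_trans h /h; have [->|S1] := eqVneq S 0; first by rewrite sqr_ge0.
by rewrite expr2 ler_pM2r// lt_def S1.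
Qed.

End SchattenNormBounds.

(** * Positions of the chains *)

Section ChainLayout.
Context {R : realType}.

(** Row i of the array G lists the values at the positions of chain i. *)
Definition embed k d m n (e : 'I_k -> 'I_d -> 'I_m * 'I_n) (G : 'M[R]_(k, d)) :
    'M[R]_(m, n) :=
  \matrix_(a, b) \sum_i \sum_j (e i j == (a, b))%:R * G i j.

Definition layout_injective k d m n (e : 'I_k -> 'I_d -> 'I_m * 'I_n) :=
  forall i j i' j', e i j = e i' j' -> i = i' /\ j = j'.

Lemma embedE k d m n (e : 'I_k -> 'I_d -> 'I_m * 'I_n) G i j :
  layout_injective e -> embed e G (e i j).1 (e i j).2 = G i j.
Proof.
move=> ei; rewrite mxE -surjective_pairing (bigD1 i)//= (bigD1 j)//= eqxx mul1r.
rewrite big1 => [|j' jj']; last first.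
  by case: eqVneq => [/ei[_ jj]|]; rewrite ?mul0r//; rewrite jj eqxx in jj'.
rewrite addr0 big1 ?addr0// => i' ii'; rewrite big1// => j' _.
by case: eqVneq => [/ei[ii _]|]; rewrite ?mul0r//; rewrite ii eqxx in ii'.
Qed.

Lemma embed_out k d m n (e : 'I_k -> 'I_d -> 'I_m * 'I_n) G a b :
  (forall i j, e i j != (a, b)) -> embed e G a b = 0.
Proof.
move=> eab; rewrite mxE big1// => i _; rewrite big1// => j _.
by rewrite (negPf (eab i j)) mul0r.
Qed.

Lemma embedB k d m n (e : 'I_k -> 'I_d -> 'I_m * 'I_n) G H :
  embed e G - embed e H = embed e (G - H).
Proof.
apply/matrixP => a b; rewrite !mxE -sumrB; apply: eq_bigr => i _.
by rewrite -sumrB; apply: eq_bigr => j _; rewrite !mxE mulrBr.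
Qed.

Lemma sum_inj_support (I J : finType) (c : J -> I) (f : I -> R) :
  injective c -> (forall i, (forall j, c j != i) -> f i = 0) ->
  \sum_i f i = \sum_j f (c j).
Proof.
move=> ci f0; rewrite (bigID (fun i => i \in [set c j | j in [set: J]]))/=.
rewrite [X in _ + X]big1 ?addr0 => [|i ic]; last first.
  by apply: f0 => j; apply: contraNneq ic => <-; exact: imset_f.
rewrite big_imset/=; last by move=> ? ? _ _; exact: ci.
by apply: eq_bigl => j; rewrite inE.
Qed.

Lemma embed_row_orthogonal k d n (c : 'I_k -> 'I_d -> 'I_n) (G : 'M[R]_(k, d)) :
  (forall i j i' j', c i j = c i' j' -> i = i' /\ j = j') ->
  let A := embed (fun i j => (i, c i j)) G in
  A *m A^T = diag_mx (\row_i \sum_j G i j ^+ 2).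
Proof.
move=> ci A; have ei : layout_injective (fun i j => (i, c i j)).
  by move=> i j i' j' [_ /ci].
apply/matrixP => a a'; rewrite !mxE; case: eqVneq => [<-|aa'] /=.
  rewrite mulr1n (eq_bigr (fun b => A a b ^+ 2)) => [|b _]; last by rewrite !mxE expr2.
  rewrite (@sum_inj_support _ _ (c a))//.
  - by apply: eq_bigr => j _; rewrite -(embedE G a j ei).
  - by move=> j j' /ci[].
  - move=> b cb; rewrite /A embed_out ?expr0n// => i j.
    by apply/eqP => -[ia cij]; have := cb j; rewrite -ia cij eqxx.
rewrite mulr0n big1// => b _; rewrite [X in _ * X]mxE.
have [/existsP[j /eqP cj]|/existsPn Ncb] := boolP [exists j, c a j == b].
  rewrite [A a' b]embed_out ?mulr0// => i j'; apply/eqP => -[ia' cij].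
  by move: cij; rewrite -cj ia' => /ci[] /esym/eqP; rewrite (negPf aa').
rewrite [A a b]embed_out ?mul0r// => i j'; apply/eqP => -[ia cij].
by have := Ncb j'; rewrite -ia cij eqxx.
Qed.

Lemma trmx_embed k d m n (e : 'I_k -> 'I_d -> 'I_m * 'I_n) (G : 'M[R]_(k, d)) :
  (embed e G)^T = embed (fun i j => ((e i j).2, (e i j).1)) G.
Proof.
apply/matrixP => a b; rewrite !mxE; apply: eq_bigr => i _; apply: eq_bigr => j _.
by case: (e i j) => x y /=; rewrite !xpair_eqE andbC.
Qed.

(** What the hard instance needs from the positions of its k chains of length
    d: across the chains, the nuclear and spectral norms act as the sum and the
    maximum of the Euclidean norms of the chains. *)
Record chain_layout k d m n (e : 'I_k -> 'I_d -> 'I_m * 'I_n) : Prop := {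
  layout_inj : layout_injective e ;
  nuclear_norm_embed : forall G : 'M[R]_(k, d),
    nuclear_norm (embed e G) = \sum_i Num.sqrt (\sum_j G i j ^+ 2) ;
  chain_le_spectral_norm : forall (A : 'M[R]_(m, n)) i,
    Num.sqrt (\sum_j A (e i j).1 (e i j).2 ^+ 2) <= spectral_norm A }.

Lemma ler_sum_inj (I J : finType) (c : J -> I) (f : I -> R) :
  injective c -> (forall i, 0 <= f i) -> \sum_j f (c j) <= \sum_i f i.
Proof.
move=> ci f0; rewrite [leRHS](bigID (fun i => i \in [set c j | j in [set: J]]))/=.
rewrite big_imset/=; last by move=> ? ? _ _; exact: ci.
rewrite [X in _ <= X + _](eq_bigl xpredT) => [|j]; last by rewrite inE.
by rewrite lerDl sumr_ge0.
Qed.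

(** Chain number i occupies the columns i d, ..., i d + d - 1 of row i, or, in
    a tall matrix, the corresponding rows of column i. *)
Lemma exists_chain_layout m n d : (minn m n * d <= maxn m n)%N ->
  exists e : 'I_(minn m n) -> 'I_d -> 'I_m * 'I_n, chain_layout e.
Proof.
move=> kd; have bd k N (kdN : (k * d <= N)%N) (i : 'I_k) (j : 'I_d) : (i * d + j < N)%N.
  rewrite (leq_trans _ kdN)// (leq_trans (n := (i.+1 * d)%N))//.
    by rewrite mulSn addnC ltn_add2r.
  by rewrite leq_mul2r ltn_ord orbT.
have ci k N (kdN : (k * d <= N)%N) i j i' j' :
    Ordinal (bd k N kdN i j) = Ordinal (bd k N kdN i' j') -> i = i' /\ j = j'.
  move=> /(congr1 val)/= E.
  have d0 : (0 < d)%N by apply: leq_ltn_trans (ltn_ord j).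
  have ii : i = i' :> nat.
    by have := congr1 (divn^~ d) E; rewrite !divnMDl// !divn_small ?addn0.
  by split; apply: val_inj => //; move: E; rewrite ii => /addnI.
have [mn|/ltnW mn] := leqP m n; rewrite ?(minn_idPl mn) ?(maxn_idPr mn)
  ?(minn_idPr mn) ?(maxn_idPl mn) in kd *.
- exists (fun i j => (i, Ordinal (bd m n kd i j))); split.
  + by move=> i j i' j' [_ E]; apply: (ci m n kd); exact: val_inj.
  + move=> G; have /nuclear_norm_row_orthogonal -> := embed_row_orthogonal G (ci m n kd).
    by apply: eq_bigr => i _; rewrite mxE.
  + move=> A i /=; apply: le_trans (row_le_spectral_norm A i).
    rewrite ler_wsqrtr// (@ler_sum_inj _ _ (fun j => Ordinal (bd m n kd i j)) (fun b => A i b ^+ 2))//.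
      by move=> j j' /ci[].
    by move=> b; exact: sqr_ge0.
- exists (fun i j => (Ordinal (bd n m kd i j), i)); split.
  + by move=> i j i' j' [E _]; apply: (ci n m kd); exact: val_inj.
  + move=> G; have := embed_row_orthogonal G (ci n m kd).
    rewrite -[embed _ _]trmxK trmx_embed /= trmxK => /nuclear_norm_col_orthogonal ->.
    by apply: eq_bigr => i _; rewrite mxE.
  + move=> A i /=; apply: le_trans (col_le_spectral_norm A i).
    rewrite ler_wsqrtr// (@ler_sum_inj _ _ (fun j => Ordinal (bd n m kd i j)) (fun b => A b i ^+ 2))//.
      by move=> j j' /ci[].
    by move=> b; exact: sqr_ge0.
Qed.

End ChainLayout.

(** * Scalar building blocks *)

Section ScalarPieces.
Context {R : realType}.
Implicit Types s t h : R.

Definition clamp t : R := Num.max 0 (Num.min 1 t).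

Lemma clampP t : [\/ t <= 0 /\ clamp t = 0, 0 <= t <= 1 /\ clamp t = t |
  1 <= t /\ clamp t = 1].
Proof.
rewrite /clamp maxEle minEle; case: (leP 1 t) => t1.
  by rewrite ler01; apply: Or33.
case: (leP 0 t) => t0; last by apply: Or31; split=> //; exact: ltW.
by apply: Or32; split => //; rewrite (ltW t1).
Qed.

(** The C^{1,1} transition from 0 on the negative axis to 1 on [1, oo). *)
Definition step t : R := clamp t ^+ 2 * (3 - 2 * clamp t).
Definition dstep t : R := 6 * clamp t * (1 - clamp t).

Lemma clamp_ge0 t : 0 <= clamp t.
Proof. by case: (clampP t) => -[t0 ->] //; case/andP: t0. Qed.

Lemma clamp_le1 t : clamp t <= 1.
Proof. by case: (clampP t) => -[t0 ->] //; case/andP: t0. Qed.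

Lemma clamp_lip s t : `|clamp s - clamp t| <= `|s - t|.
Proof.
rewrite ler_norml; apply/andP.
by case: (ger0P (s - t)) => st; case: (clampP s) => -[s0 ->]; case: (clampP t) => -[t0 ->];
  split; lra.
Qed.

Lemma step_ge0 t : 0 <= step t.
Proof. by rewrite mulr_ge0 ?sqr_ge0//; have := clamp_le1 t; lra. Qed.

Lemma step_le1 t : step t <= 1.
Proof.
rewrite /step; have := clamp_le1 t; have := clamp_ge0 t.
move: (clamp t) => s s0 s1; rewrite -subr_ge0.
rewrite (_ : _ - _ = (1 - s) ^+ 2 * (1 + 2 * s)); last by ring.
by rewrite mulr_ge0 ?sqr_ge0//; lra.
Qed.

Lemma step_le0 t : t <= 0 -> step t = 0.
Proof.
by move=> t0; rewrite /step (_ : clamp t = 0) ?expr0n ?mul0r//; case: (clampP t) => -[t1 ->] //; lra.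
Qed.

Lemma step_ge1 t : 1 <= t -> step t = 1.
Proof.
by move=> t0; rewrite /step (_ : clamp t = 1); [lra|]; case: (clampP t) => -[t1 ->] //; lra.
Qed.

Lemma dstep_ge0 t : 0 <= dstep t.
Proof. by rewrite !mulr_ge0 ?clamp_ge0// subr_ge0 clamp_le1. Qed.

Lemma dstep_le t : dstep t <= 3 / 2.
Proof.
have := sqr_ge0 (clamp t - 2^-1).
by rewrite /dstep; move: (clamp t) => s; nra.
Qed.

Lemma dstep_le0 t : t <= 0 -> dstep t = 0.
Proof.
by move=> t0; rewrite /dstep (_ : clamp t = 0) ?mulr0 ?mul0r//; case: (clampP t) => -[t1 ->] //; lra.
Qed.

Lemma step_lip s t : `|step s - step t| <= 3 / 2 * `|s - t|.
Proof.
rewrite (_ : step s - step t = (3 * (clamp s + clamp t) -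
  2 * (clamp s ^+ 2 + clamp s * clamp t + clamp t ^+ 2)) * (clamp s - clamp t)); last first.
  by rewrite /step; ring.
rewrite normrM ler_pM// ?clamp_lip//.
have := clamp_le1 s; have := clamp_ge0 s; have := clamp_le1 t; have := clamp_ge0 t.
move: (clamp s) (clamp t) => a b b0 b1 a0 a1.
rewrite ler_norml; apply/andP; split; first by nra.
have : 0 <= (2 * (a - 2^-1) + (b - 2^-1)) ^+ 2 by exact: sqr_ge0.
have : 0 <= (b - 2^-1) ^+ 2 by exact: sqr_ge0.
by nra.
Qed.

Lemma dstep_lip s t : `|dstep s - dstep t| <= 6 * `|s - t|.
Proof.
rewrite (_ : dstep s - dstep t = (6 * (1 - clamp s - clamp t)) * (clamp s - clamp t)); last first.
  by rewrite /dstep; ring.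
rewrite normrM ler_pM// ?clamp_lip//.
have := clamp_le1 s; have := clamp_ge0 s; have := clamp_le1 t; have := clamp_ge0 t.
by rewrite ler_norml => *; apply/andP; split; lra.
Qed.

Lemma step_taylor t h : `|step (t + h) - step t - dstep t * h| <= 12 * h ^+ 2.
Proof.
have step1 : `|dstep t * (clamp (t + h) - clamp t - h)| <= 6 * h ^+ 2.
  rewrite ler_norml /dstep -[6 * _ * _]mulrA; apply/andP.
  case: (clampP t) => -[t0 ->]; rewrite ?(mul0r, mulr0, subrr).
  1,3: by have := sqr_ge0 h; split; lra.
  have [u0 u1 u2] : [/\ 0 <= t * (1 - t), t * (1 - t) <= t & t * (1 - t) <= 1 - t].
    by split; nra.
  move: (t * (1 - t)) u0 u1 u2 => u u0 u1 u2.
  by case: (clampP (t + h)) => -[th ->]; split; nra.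
have step2 : `|step (t + h) - step t - dstep t * (clamp (t + h) - clamp t)| <=
    6 * h ^+ 2.
  have : (clamp (t + h) - clamp t) ^+ 2 <= h ^+ 2.
    have := clamp_lip (t + h) t; rewrite [t + h - t]addrC addKr => lip.
    by rewrite -real_normK ?num_real// -[leRHS]real_normK ?num_real// ler_sqr ?nnegrE.
  rewrite (_ : step _ - _ - _ = (3 - 2 * clamp (t + h) - 4 * clamp t) *
    (clamp (t + h) - clamp t) ^+ 2); last by rewrite /step /dstep; ring.
  have := clamp_le1 (t + h); have := clamp_ge0 (t + h).
  have := clamp_le1 t; have := clamp_ge0 t.
  move: (clamp t) (clamp _) => a b a0 a1 b0 b1 le.
  rewrite normrM [`|_ ^+ 2|]ger0_norm ?sqr_ge0// ler_pM ?sqr_ge0//.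
  by rewrite ler_norml; apply/andP; split; lra.
rewrite (_ : _ - _ = (step (t + h) - step t - dstep t * (clamp (t + h) - clamp t)) +
  dstep t * (clamp (t + h) - clamp t - h)); last by ring.
by rewrite (le_trans (ler_normD _ _))//; lra.
Qed.

(** The counterpart of step that is still increasing at 0: an increment of the
    next variable pays off as soon as the previous one is positive. *)
Definition ramp t : R := 4 * step ((t + 2) / 4).
Definition dramp t : R := dstep ((t + 2) / 4).

Lemma ramp_ge0 t : 0 <= ramp t.
Proof. by rewrite mulr_ge0 ?step_ge0. Qed.

Lemma ramp_le4 t : ramp t <= 4.
Proof. by rewrite /ramp; have := step_le1 ((t + 2) / 4); lra. Qed.

Lemma ramp_lip s t : `|ramp s - ramp t| <= 3 / 2 * `|s - t|.
Proof.
rewrite -mulrBr normrM gtr0_norm//; have := step_lip ((s + 2) / 4) ((t + 2) / 4).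
rewrite (_ : _ / 4 - _ = (s - t) / 4); last by field.
by rewrite [`|(s - t) / 4|]normrM [`|4^-1|]gtr0_norm//; lra.
Qed.

Lemma dramp_lip s t : `|dramp s - dramp t| <= 3 / 2 * `|s - t|.
Proof.
have := dstep_lip ((s + 2) / 4) ((t + 2) / 4).
rewrite (_ : _ / 4 - _ = (s - t) / 4); last by field.
by rewrite [`|(s - t) / 4|]normrM [`|4^-1|]gtr0_norm// /dramp; lra.
Qed.

Lemma ramp_taylor t h : `|ramp (t + h) - ramp t - dramp t * h| <= 12 * h ^+ 2.
Proof.
rewrite (_ : _ - _ = 4 * (step ((t + h + 2) / 4) - step ((t + 2) / 4) - dramp t * (h / 4))).
  rewrite normrM gtr0_norm//; have := step_taylor ((t + 2) / 4) (h / 4).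
  rewrite (_ : _ / 4 + _ = (t + h + 2) / 4); last by field.
  by move=> le1; rewrite (le_trans (ler_wpM2l _ le1))//; nra.
by rewrite /ramp; field.
Qed.

(** Prevents a variable from escaping to the flat part of ramp on the left. Its
    derivative has the sign of the other terms, so that nothing cancels. *)
Definition penalty t : R := Num.max 0 (- t) ^+ 2 / 2.
Definition dpenalty t : R := - Num.max 0 (- t).

Lemma penalty_ge0 t : 0 <= penalty t.
Proof. by rewrite divr_ge0 ?sqr_ge0. Qed.

Lemma dpenalty_le0 t : dpenalty t <= 0.
Proof. by rewrite /dpenalty oppr_le0 le_max lexx. Qed.

Lemma dpenalty0 : dpenalty 0 = 0.
Proof. by rewrite /dpenalty oppr0 maxxx oppr0. Qed.

Lemma dpenalty_lip s t : `|dpenalty s - dpenalty t| <= `|s - t|.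
Proof.
rewrite ler_norml /dpenalty !maxEle; apply/andP.
by case: (ger0P (s - t)) => st; case: (leP 0 (- s)) => s0; case: (leP 0 (- t)) => t0;
  split; lra.
Qed.

Lemma penalty_taylor t h : `|penalty (t + h) - penalty t - dpenalty t * h| <= 12 * h ^+ 2.
Proof.
rewrite ler_norml /dpenalty /penalty !maxEle; apply/andP.
by case: (leP 0 (- (t + h))) => s0; case: (leP 0 (- t)) => t0; split; nra.
Qed.

(** On [-1, 1] the first summand is large; further left the penalty takes over. *)
Lemma dramp_sub_dpenalty_ge1 t : t <= 1 -> 1 <= dramp t - dpenalty t.
Proof.
move=> t1; have : dpenalty t <= 0 by exact: dpenalty_le0.
have := dstep_ge0 ((t + 2) / 4); rewrite -/(dramp t) => d0.
have [tN|tN] := leP t (- 1).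
  suff : dpenalty t <= - 1 by lra.
  by rewrite /dpenalty lerN2 le_max; apply/orP; right; lra.
move=> ?; suff : 1 <= dramp t by lra.
by rewrite /dramp /dstep; case: (clampP ((t + 2) / 4)) => -[t0 ->]; nra.
Qed.

End ScalarPieces.

(** * The hard objective *)

(** A quadratic bound on the remainder of the first order expansion, rather than
    a case analysis at the points where a piecewise formula changes. *)
Lemma is_derive_quadratic (R : realType) (V : normedModType R) (f : V -> R) (x v : V) (l C : R) :
  (forall h : R, `|f (h *: v + x) - f x - h * l| <= C * h ^+ 2) ->
  is_derive x v f l.
Proof.
move=> fC; suff cvl :
    ((fun h : R => h^-1 *: ((f \o shift x) (h *: v) - f x)) @ 0^' --> l)%classic.
  by split; [apply: (cvgP l)|apply: cvg_lim].
have C1 : 0 < `|C| + 1 by rewrite ltr_wpDl.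
apply/cvgrPdist_le => /= eps eps0; near=> h.
have h0 : h != 0 by near: h; exact: nbhs_dnbhs_neq.
rewrite -[X in X - _](mulKf h0) -mulrBr normrM normfV ler_pdivrMl ?normr_gt0//.
rewrite distrC (le_trans (fC h))// -[h ^+ 2]real_normK ?num_real// expr2 mulrA mulrC.
rewrite ler_pM2l ?normr_gt0//.
apply: (@le_trans _ _ ((`|C| + 1) * `|h|)).
  by rewrite ler_wpM2r// (le_trans (ler_norm _))// lerDl.
by rewrite -ler_pdivlMl//; near: h; apply: dnbhs0_le; rewrite mulr_gt0 ?invr_gt0.
Unshelve. all: by end_near. Qed.

Section HardFunction.
Context {R : realType} {k d m n : nat}.
Variables (e : 'I_k -> 'I_d -> 'I_m * 'I_n) (lam mu : R).
Implicit Types (i : 'I_k) (x v : 'M[R]_(m, n)).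

Lemma is_derive_comp_taylor (V : normedModType R) (g dg : R -> R) (f : V -> R) (x v : V) (l : R) :
  (forall t h, `|g (t + h) - g t - dg t * h| <= 12 * h ^+ 2) ->
  (forall h : R, f (h *: v + x) = f x + h * l) ->
  is_derive x v (g \o f) (dg (f x) * l).
Proof.
move=> gC fl; apply: (@is_derive_quadratic _ _ _ _ _ _ (12 * l ^+ 2)) => h /=.
by rewrite fl mulrCA (le_trans (gC _ _))// exprMn; lra.
Qed.

(** Chain i read off x, with the constant 1 before its first variable and
    zeros after its last one. *)
Definition site i (j : nat) x : R :=
  if j is j'.+1 then
    if insub j' is Some j'' then x (e i j'').1 (e i j'').2 / lam else 0
  else 1.

Arguments site : simpl never.

Definition dsite i (j : nat) v : R := if j is 0 then 0 else site i j v.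

(** The factor step (y j) hides the next variable, up to its penalty, until y j
    is positive. *)
Definition link (y : nat -> R) (j : nat) : R := penalty (y j.+1) - step (y j) * ramp (y j.+1).

(** The derivative of the sum of the links with respect to variable j of the
    chain, which sits at index j.+1. All three terms are nonpositive. *)
Definition partial (y : nat -> R) (j : nat) : R :=
  dpenalty (y j.+1) - step (y j) * dramp (y j.+1) - dstep (y j.+1) * ramp (y j.+2).

Definition hard x : R :=
  mu * \sum_(i < k) \sum_(j < d.+1) link (fun l => site i l x) j.

Lemma siteD i j x v h : site i j (h *: v + x) = site i j x + h * dsite i j v.
Proof.
case: j => [|j]; first by rewrite /= mulr0 addr0.
rewrite /dsite /site; case: insubP => [j' _ _|_]; last by rewrite mulr0 addr0.
by rewrite !mxE mulrDl addrC mulrA.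
Qed.

Lemma site_ord i (j : 'I_d) x : site i j.+1 x = x (e i j).1 (e i j).2 / lam.
Proof. by rewrite /site valK. Qed.

Lemma site_last i x : site i d.+1 x = 0.
Proof. by rewrite /site insubF// ltnn. Qed.

Lemma is_derive_link i j x v :
  is_derive x v (fun x => link (fun l => site i l x) j)
    ((dpenalty (site i j.+1 x) - step (site i j x) * dramp (site i j.+1 x)) *
       dsite i j.+1 v -
     dstep (site i j x) * ramp (site i j.+1 x) * dsite i j v).
Proof.
have dpen := is_derive_comp_taylor penalty_taylor (siteD i j.+1 x v).
have dbum := is_derive_comp_taylor ramp_taylor (siteD i j.+1 x v).
have dste := is_derive_comp_taylor step_taylor (siteD i j x v).
apply: (is_derive_eq (is_deriveB dpen (is_deriveM dste dbum))).
by rewrite /GRing.scale /=; ring.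
Qed.

Lemma is_derive_hard x v : is_derive x v hard
  (mu * \sum_(i < k) \sum_(j < d)
     partial (fun l => site i l x) j * (v (e i j).1 (e i j).2 / lam)).
Proof.
have dlink i := is_derive_sum (fun j : 'I_d.+1 => is_derive_link i j x v).
have := is_deriveZ mu (is_derive_sum dlink).
rewrite [X in is_derive _ _ X](_ : _ = hard); last first.
  apply/funext => z; rewrite /hard /= !fct_sumE; congr (_ * _).
  by apply: eq_bigr => i _; rewrite fct_sumE.
move=> /is_derive_eq; apply; congr (_ * _); apply: eq_bigr => i _.
pose w := fun j : 'I_d => v (e i j).1 (e i j).2 / lam.
have sumA (a : nat -> R) : \sum_(j < d.+1) a j * dsite i j.+1 v = \sum_(j < d) a j * w j.
  rewrite big_ord_recr/= site_last mulr0 addr0.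
  by apply: eq_bigr => j _; rewrite site_ord.
have sumB (b : nat -> R) : \sum_(j < d.+1) b j * dsite i j v = \sum_(j < d) b j.+1 * w j.
  rewrite big_ord_recl/= mulr0 add0r.
  by apply: eq_bigr => j _; rewrite site_ord.
rewrite sumrB.
rewrite (sumA (fun j => dpenalty (site i j.+1 x) - step (site i j x) * dramp (site i j.+1 x))).
rewrite (sumB (fun j => dstep (site i j x) * ramp (site i j.+1 x))).
by rewrite -sumrB; apply: eq_bigr => j _; rewrite /partial /w; ring.
Qed.

Lemma differentiable_site i j x : differentiable (site i j) x.
Proof.
case: j => [|j]; first exact: differentiable_cst.
rewrite /site; case: insubP => [j' _ _|_]; last exact: differentiable_cst.
rewrite (_ : (fun _ => _) = lam^-1 \*: (fun x : 'M[R]_(m, n) => x (e i j').1 (e i j').2)).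
  by apply: differentiableZ; exact: differentiable_coord.
by apply/funext => z; rewrite /= mulrC.
Qed.

Lemma differentiable_taylor (g dg : R -> R) t :
  (forall t h, `|g (t + h) - g t - dg t * h| <= 12 * h ^+ 2) -> differentiable g t.
Proof.
move=> gC; apply/derivable1_diffP.
have idD h : id (h *: (1 : R) + t) = id t + h * 1 :> R by rewrite /GRing.scale/= addrC.
by have [] := @is_derive_comp_taylor R^o g dg id t 1 1 gC idD.
Qed.

Lemma differentiable_hard x : differentiable hard x.
Proof.
rewrite (_ : hard = mu \*: \sum_(i < k) \sum_(j < d.+1)
    (penalty \o site i j.+1 - (step \o site i j) * (ramp \o site i j.+1))).
  apply: differentiableZ; apply: differentiable_sum => i.
  apply: differentiable_sum => j; apply: differentiableB; last apply: differentiableM.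
  - apply: differentiable_comp (differentiable_site _ _ _) _.
    exact: differentiable_taylor penalty_taylor.
  - apply: differentiable_comp (differentiable_site _ _ _) _.
    exact: differentiable_taylor step_taylor.
  - apply: differentiable_comp (differentiable_site _ _ _) _.
    exact: differentiable_taylor ramp_taylor.
apply/funext => z; rewrite /hard /= !fct_sumE; congr (_ * _).
by apply: eq_bigr => i _; rewrite fct_sumE.
Qed.

(** The partial derivatives of hard, arranged by chains. *)
Definition chain_gradient x : 'M[R]_(k, d) :=
  \matrix_(i, j) (mu / lam * partial (fun l => site i l x) j).

Lemma gradient_hard x : gradient hard x = embed e (chain_gradient x).
Proof.
apply/matrixP => a b; rewrite !mxE; have [_ ->] := is_derive_hard x (delta_mx a b).
rewrite mulr_sumr; apply: eq_bigr => i _; rewrite mulr_sumr; apply: eq_bigr => j _.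
by rewrite !mxE -xpair_eqE -surjective_pairing; ring.
Qed.

Lemma hard_lb x : 0 <= mu -> - (mu * (k * d.+1 * 4)%:R) <= hard x.
Proof.
move=> mu0; rewrite -mulrN ler_wpM2l//.
rewrite [leLHS](_ : _ = \sum_(i < k) \sum_(j < d.+1) (- 4)); last first.
  by rewrite !sumr_const !card_ord -[RHS]mulr_natr -[- 4 *+ _]mulr_natr !natrM; ring.
apply: ler_sum => i _; apply: ler_sum => j _; rewrite /link.
set t := site i j x; set s := site i j.+1 x.
have := penalty_ge0 s; have := step_ge0 t; have := step_le1 t; have := ramp_ge0 s.
have := ramp_le4 s; move: (step t) (ramp s) => a b; nra.
Qed.

Lemma hard0 : 0 <= mu -> hard 0 <= 0.
Proof.
move=> mu0; rewrite mulr_ge0_le0//; apply: sumr_le0 => i _; apply: sumr_le0 => j _.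
rewrite /link (_ : site i j.+1 0 = 0).
  rewrite /penalty oppr0 maxxx expr0n mul0r sub0r oppr_le0.
  by rewrite mulr_ge0 ?step_ge0 ?ramp_ge0.
by rewrite /site; case: insubP => // *; rewrite mxE mul0r.
Qed.

End HardFunction.

Section Chains.
Context {R : realType}.
Implicit Types y z : nat -> R.

Lemma partial_lip y z j : `|partial y j - partial z j| <=
  27 * (`|y j - z j| + `|y j.+1 - z j.+1| + `|y j.+2 - z j.+2|).
Proof.
rewrite /partial; set y0 := y j; set y1 := y j.+1; set y2 := y j.+2.
set z0 := z j; set z1 := z j.+1; set z2 := z j.+2.
have h1 : `|(step y0 - step z0) * dramp y1| <= 9 / 4 * `|y0 - z0|.
  rewrite normrM [`|dramp _|]ger0_norm ?dstep_ge0//.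
  have := step_lip y0 z0; have := dstep_le ((y1 + 2) / 4); have := dstep_ge0 ((y1 + 2) / 4).
  rewrite -/(dramp _); have := normr_ge0 (step y0 - step z0).
  by move: `|_ - _| `|_ - _| (dramp _) => a b c; nra.
have h2 : `|step z0 * (dramp y1 - dramp z1)| <= 3 / 2 * `|y1 - z1|.
  rewrite normrM ger0_norm ?step_ge0//.
  have := dramp_lip y1 z1; have := step_le1 z0; have := step_ge0 z0.
  have := normr_ge0 (dramp y1 - dramp z1).
  by move: `|_ - _| `|_ - _| (step _) => a b c; nra.
have h3 : `|(dstep y1 - dstep z1) * ramp y2| <= 24 * `|y1 - z1|.
  rewrite normrM [`|ramp _|]ger0_norm ?ramp_ge0//.
  have := dstep_lip y1 z1; have := ramp_le4 y2; have := ramp_ge0 y2.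
  have := normr_ge0 (dstep y1 - dstep z1).
  by move: `|_ - _| `|_ - _| (ramp _) => a b c; nra.
have h4 : `|dstep z1 * (ramp y2 - ramp z2)| <= 9 / 4 * `|y2 - z2|.
  rewrite normrM ger0_norm ?dstep_ge0//.
  have := ramp_lip y2 z2; have := dstep_le z1; have := dstep_ge0 z1.
  have := normr_ge0 (ramp y2 - ramp z2).
  by move: `|_ - _| `|_ - _| (dstep _) => a b c; nra.
have h5 := dpenalty_lip y1 z1.
rewrite (_ : _ - _ = (dpenalty y1 - dpenalty z1) - ((step y0 - step z0) * dramp y1 +
   step z0 * (dramp y1 - dramp z1)) - ((dstep y1 - dstep z1) * ramp y2 +
   dstep z1 * (ramp y2 - ramp z2))); last by ring.
apply: le_trans (ler_normB _ _) _; apply: le_trans (lerD (ler_normB _ _) (ler_normD _ _)) _.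
apply: le_trans (lerD (lerD (lexx _) (ler_normD _ _)) (lexx _)) _.
have := normr_ge0 (y0 - z0); have := normr_ge0 (y2 - z2); have := normr_ge0 (y1 - z1).
by lra.
Qed.

(** Each difference of partial derivatives involves three consecutive
    variables, whence 27 * 3 = 81. *)
Lemma sum_partial_lip d y z : y 0 = z 0 -> y d.+1 = z d.+1 ->
  \sum_(j < d) (partial y j - partial z j) ^+ 2 <=
  81 ^+ 2 * \sum_(j < d) (y j.+1 - z j.+1) ^+ 2.
Proof.
move=> yz0 yzd; pose w j := (y j - z j) ^+ 2.
have w0 j : 0 <= w j by exact: sqr_ge0.
apply: (@le_trans _ _ (\sum_(j < d) 27 ^+ 2 * 3 * (w j + w j.+1 + w j.+2))).
  apply: ler_sum => j _; have := partial_lip y z j; rewrite /w.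
  move: (y j - z j) (y j.+1 - _) (y j.+2 - _) (_ - _) => a b c p pabc.
  rewrite -[p ^+ 2]real_normK ?num_real//.
  rewrite -[a ^+ 2]real_normK ?num_real// -[b ^+ 2]real_normK ?num_real//.
  rewrite -[c ^+ 2]real_normK ?num_real//.
  move: `|p| `|a| `|b| `|c| (normr_ge0 p) pabc => {}p {}a {}b {}c p0 pabc.
  apply: (@le_trans _ _ ((27 * (a + b + c)) ^+ 2)).
    by rewrite lerXn2r// ?nnegrE// (le_trans p0).
  have := sqr_ge0 (a - b); have := sqr_ge0 (b - c); have := sqr_ge0 (a - c); nra.
have wd : \sum_(j < d) w j <= \sum_(j < d) w j.+1.
  have : \sum_(j < d.+1) w j = \sum_(j < d) w j.+1.
    by rewrite big_ord_recl /= {1}/w yz0 subrr expr0n add0r.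
  by rewrite big_ord_recr/= => <-; rewrite lerDl.
have wd2 : \sum_(j < d) w j.+2 <= \sum_(j < d) w j.+1.
  have : \sum_(j < d.+1) w j.+1 = \sum_(j < d) w j.+1.
    by rewrite big_ord_recr /= {2}/w yzd subrr expr0n addr0.
  by rewrite big_ord_recl/= => <-; rewrite lerDr.
by rewrite -mulr_sumr !big_split/=; move: wd wd2; rewrite -/w; lra.
Qed.

Lemma partial_zero y j : y j = 0 -> y j.+1 = 0 -> partial y j = 0.
Proof.
by move=> y0 y1; rewrite /partial y0 y1 dpenalty0 step_le0// dstep_le0// !mul0r !subr0.
Qed.

Lemma partial_frontier y j : y j.+1 = 0 -> `|partial y j| <= 3 / 2.
Proof.
move=> y1; rewrite /partial y1 dpenalty0 dstep_le0// mul0r sub0r subr0 normrN.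
rewrite ger0_norm ?(mulr_ge0 (step_ge0 _) (dstep_ge0 _))//.
apply: le_trans (ler_pM (step_ge0 _) (dstep_ge0 _) (step_le1 _) (dstep_le _)) _.
by rewrite mul1r.
Qed.

(** The witness is the first variable below 1. *)
Lemma unfinished_partial d y : (0 < d)%N -> y 0 = 1 -> y d = 0 ->
  exists j : 'I_d, 1 <= `|partial y j|.
Proof.
move=> d0 y0 yd; have ex : exists j, y j.+1 < 1 by exists d.-1; rewrite prednK// yd.
have [j yj1 jmin] := ex_minnP ex.
have jd : (j < d)%N.
  by rewrite -(prednK d0) ltnS; apply: jmin; rewrite prednK// yd.
exists (Ordinal jd) => /=; have yj : 1 <= y j.
  case: (j) jmin => [|l] lmin; first by rewrite y0.
  by rewrite leNgt; apply/negP => /lmin; rewrite ltnn.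
have := dramp_sub_dpenalty_ge1 (ltW yj1).
have := mulr_ge0 (dstep_ge0 (y j.+1)) (ramp_ge0 (y j.+2)).
rewrite /partial (step_ge1 yj) mul1r => h1 h2.
by rewrite -normrN (le_trans _ (ler_norm _))//; lra.
Qed.

Context {k d m n : nat} (e : 'I_k -> 'I_d -> 'I_m * 'I_n) (lam mu : R).
Hypotheses (layout : chain_layout (R := R) e) (lam_gt0 : 0 < lam) (mu_ge0 : 0 <= mu).

Lemma gradient_hard_lip (x y : 'M[R]_(m, n)) :
  nuclear_norm (gradient (hard e lam mu) x - gradient (hard e lam mu) y) <=
  k%:R * (mu * 81 / lam ^+ 2) * spectral_norm (x - y).
Proof.
rewrite !gradient_hard embedB (nuclear_norm_embed layout) -mulrA mulr_natl -[X in _ *+ X]card_ord.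
rewrite -sumr_const; apply: ler_sum => i _.
have c0 : 0 <= mu * 81 / lam ^+ 2 by rewrite divr_ge0 ?sqr_ge0 ?mulr_ge0.
apply: le_trans (ler_wpM2l c0 (chain_le_spectral_norm layout (x - y) i)).
rewrite -[X in X * _]ger0_norm// -sqrtr_sqr -sqrtrM ?sqr_ge0// ler_wsqrtr//.
have := sum_partial_lip (d := d) (y := fun l => site e lam i l x)
  (z := fun l => site e lam i l y) erefl.
rewrite !site_last => /(_ erefl) /(ler_wpM2l (sqr_ge0 (mu / lam))).
rewrite mulr_sumr => h; apply: le_trans (le_trans h _).
  by apply: ler_sum => j _; rewrite !mxE -mulrBr exprMn.
rewrite !mulr_sumr; apply: ler_sum => j _; rewrite !site_ord !mxE.
by rewrite -mulrBl le_eqVlt; apply/orP; left; apply/eqP; field; rewrite gt_eqF.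
Qed.

Lemma gradient_hard_ge x : (0 < d)%N ->
  mu / lam * #|[set i | site e lam i d x == 0]|%:R <=
  nuclear_norm (gradient (hard e lam mu) x).
Proof.
move=> d0; rewrite gradient_hard (nuclear_norm_embed layout) mulr_natr -sumr_const.
rewrite [leRHS](bigID (fun i => i \in [set i | site e lam i d x == 0]))/=.
rewrite ler_wpDr ?sumr_ge0//; apply: ler_sum => i; rewrite inE => /eqP yd.
have [j j1] := @unfinished_partial d (fun l => site e lam i l x) d0 erefl yd.
have ml0 : 0 <= mu / lam by rewrite divr_ge0// ltW.
rewrite -[leLHS]ger0_norm// -sqrtr_sqr ler_wsqrtr// (bigD1 j)//= ler_wpDr//.
  by apply: sumr_ge0 => l _; exact: sqr_ge0.
rewrite mxE [leRHS]exprMn ler_peMr ?sqr_ge0// -[leRHS]real_normK ?num_real//.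
by rewrite exprn_ege1.
Qed.

Lemma hard_in_class (Delta1 L : {posnum R}) :
  k%:R * (mu * 81 / lam ^+ 2) <= L%:num ->
  mu * (k * d.+1 * 4)%:R <= Delta1%:num ->
  in_objective_class Delta1 L (hard e lam mu).
Proof.
move=> hL hD; split.
- exact: differentiable_hard.
- move=> x y; apply: le_trans (gradient_hard_lip x y) _.
  by rewrite ler_wpM2r ?spectral_norm_ge0.
- have lb : ((- (mu * (k * d.+1 * 4)%:R))%:E <=
      ereal_inf (range (fun x => (hard e lam mu x)%:E)))%E.
    by apply: le_ereal_inf_tmp => _ [x _ <-]; rewrite lee_fin; exact: hard_lb.
  apply: le_trans (leeB (lexx _) lb) _.
  by rewrite -EFinB lee_fin opprK; have := @hard0 _ _ _ _ _ e lam mu mu_ge0; lra.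
Qed.

End Chains.

(** * Measurability in the objective *)

Section ObjectiveMeasurability.
Local Open Scope classical_set_scope.
Local Open Scope ring_scope.
Context {R : realType} {m n : nat}.
Local Notation M := 'M[R]_(m, n).

Lemma measurable_entry i j : measurable_fun setT (fun A : M => A i j).
Proof.
move=> _ B mB; rewrite setTI; apply: sub_sigma_algebra.
by exists (i, j) => //; exists B => //; rewrite setTI.
Qed.

Lemma measurable_fun_mx d (T : measurableType d) (f : T -> M) :
  (forall i j, measurable_fun setT (fun t => f t i j)) -> measurable_fun setT f.
Proof.
move=> mf; apply: (measurability (@matrix_cylinders R m n)) => // _ [_ [[i j] _ [B mB <-]] <-].
by rewrite !setTI; have := mf i j measurableT B mB; rewrite setTI.
Qed.

Lemma measurable_fun_countable d (T : measurableType d) (I : countType)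
    (g : T -> I) (f : I -> T -> R) :
  (forall i, measurable (g @^-1` [set i])) -> (forall i, measurable_fun setT (f i)) ->
  measurable_fun setT (fun t => f (g t) t).
Proof.
move=> mg mf _ B mB.
rewrite (_ : _ `&` _ = \bigcup_(i in [set: I]) (g @^-1` [set i] `&` (f i @^-1` B))).
  apply: countable_bigcupT_measurable => [|i]; first exact: countableP.
  by apply: measurableI => //; rewrite -[X in measurable X]setTI; exact: mf.
apply/seteqP; split=> [t [_ ft]|t [i _ [<- ft]]] //.
by exists (g t).
Qed.

(** Rounding to the grid of mesh 1/(q+1). *)
Definition mxfloor (q : nat) (x : M) : 'M[int]_(m, n) :=
  map_mx (fun t => Num.floor (t * q.+1%:R)) x.

Definition grid (q : nat) (z : 'M[int]_(m, n)) : M :=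
  map_mx (fun t => t%:~R / q.+1%:R) z.

Lemma grid_mxfloor_cvg x : grid q (mxfloor q x) @[q --> \oo] --> x.
Proof.
apply/cvgrPdist_le => /= eps eps0; near=> q.
rewrite /Num.norm /= mx_normrE; apply: (big_ind (fun r => r <= eps)).
- exact: ltW.
- by move=> r s rle sle; rewrite ge_max rle.
- move=> ij _; rewrite !mxE.
  have q0 : 0 < q.+1%:R :> R by rewrite ltr0n.
  have /andP[f1 f2] := floor_itv (x ij.1 ij.2 * q.+1%:R).
  set u := (Num.floor _)%:~R in f1 f2 *.
  rewrite intrD -/u in f2.
  rewrite ger0_norm; last by rewrite subr_ge0 ler_pdivrMr.
  rewrite (@le_trans _ _ (q.+1%:R^-1))//.
    by rewrite lerBlDl -[X in _ + X]mul1r -mulrDl ler_pdivlMr// ltW.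
  by near: q; apply: filterS (near_infty_natSinv_lt (PosNum eps0)) => q /ltW.
Unshelve. all: by end_near. Qed.

Lemma measurable_mxfloor q (z : 'M[int]_(m, n)) : measurable (mxfloor q @^-1` [set z]).
Proof.
rewrite (_ : _ @^-1` _ = \bigcap_(ij in [set: 'I_m * 'I_n])
   ((fun x : M => x ij.1 ij.2) @^-1` `[(z ij.1 ij.2)%:~R / q.+1%:R, (z ij.1 ij.2 + 1)%:~R / q.+1%:R[)).
  apply: fin_bigcap_measurable => // -[i j] _.
  rewrite -[X in measurable X]setTI; exact: measurable_entry.
have fE (x : M) ij :
    (x ij.1 ij.2 \in `[(z ij.1 ij.2)%:~R / q.+1%:R, (z ij.1 ij.2 + 1)%:~R / q.+1%:R[) =
    (mxfloor q x ij.1 ij.2 == z ij.1 ij.2).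
  by rewrite mxE floor_eq in_itv/= ler_pdivrMr// ltr_pdivlMr.
apply/seteqP; split=> x /=.
  by move=> fx ij _; rewrite /= fE fx.
move=> fx; apply/matrixP => i j; apply/eqP.
by have := fx (i, j) Logic.I; rewrite /= (fE _ (i, j)).
Qed.

Context {Delta1 L : {posnum R}}.
Local Notation obj := (objective m n Delta1 L).

Lemma objective_continuous (F : obj) x : {for x, continuous (F : M -> R)}.
Proof. by case: F => F [dF _ _] /=; apply: differentiable_continuous. Qed.

Lemma objective_cvg_grid (F : obj) x : F (grid q (mxfloor q x)) @[q --> \oo] --> F x.
Proof.
apply: continuous_cvg (@grid_mxfloor_cvg x); exact: objective_continuous.
Qed.

Lemma measurable_eval_at (x : M) : measurable_fun setT (fun F : obj => F x).
Proof.
move=> _ B mB; rewrite setTI; apply: sub_sigma_algebra.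
by exists x => //; exists B => //; rewrite setTI.
Qed.

(** Objectives are continuous, hence limits of their values on finer and finer
    grids, where evaluation splits into countably many measurable pieces. *)
Lemma measurable_eval : measurable_fun setT (fun w : obj * M => w.1 w.2).
Proof.
apply: (@measurable_fun_cvg _ _ R _ (fun q (w : obj * M) => w.1 (grid q (mxfloor q w.2)))); last first.
  by move=> [F x] _; exact: objective_cvg_grid.
move=> q; apply: (@measurable_fun_countable _ _ _ (fun w : obj * M => mxfloor q w.2)
  (fun z w => w.1 (grid q z))).
- move=> z; rewrite -[X in measurable X]setTI.
  have h := @measurable_snd _ _ obj M measurableT _ (measurable_mxfloor q z).
  exact: h.
- by move=> z; apply: measurableT_comp (measurable_eval_at _) measurable_fst.
Qed.

Lemma measurable_gradient :
  measurable_fun setT (fun w : obj * M => gradient w.1 w.2).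
Proof.
apply: measurable_fun_mx => i j.
pose h q : R := q.+1%:R^-1.
apply: (@measurable_fun_cvg _ _ R _
  (fun q (w : obj * M) => (h q)^-1 * (w.1 (h q *: delta_mx i j + w.2) - w.1 w.2))).
- move=> q; have mshift : measurable_fun setT
      (fun w : obj * M => (w.1, h q *: delta_mx i j + w.2) : obj * M).
    apply: measurable_fun_pair => //; apply: measurable_fun_mx => a b.
    rewrite (_ : (fun _ => _) =
        (fun w : obj * M => (h q *: delta_mx i j : M) a b + w.2 a b)).
      apply: measurable_funD => //.
      exact: measurableT_comp (measurable_entry a b) measurable_snd.
    by apply/funext => w; rewrite !mxE.
  apply: measurable_funM => //; apply: measurable_funB measurable_eval.
  exact: (measurableT_comp measurable_eval mshift).
- move=> [F x] _; rewrite /= mxE.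
  have /diff_derivable : differentiable (F : M -> R) x by case: F => F [dF _ _] /=.
  move=> /(_ (delta_mx i j)) dF.
  have h0 : h q @[q --> \oo] --> 0^'.
    move=> A hA; have : \forall q \near \oo, h q != 0 -> A (h q) by exact: (@cvg_harmonic R _ hA).
    by apply: filterS => q; apply; rewrite invr_neq0.
  have dF' : (fun t : R => t^-1 * (F (t *: delta_mx i j + x) - F x)) @ 0^' -->
      'D_(delta_mx i j) F x by exact: dF.
  exact: (cvg_comp _ _ h0 dF').
Qed.

Lemma measurable_set1_objective (F : obj) : measurable [set F].
Proof.
rewrite (_ : [set F] = \bigcap_(q in [set: nat]) ~` \bigcup_(z in [set: 'M[int]_(m, n)])
   ~` ((fun G : obj => G (grid q z)) @^-1` [set F (grid q z)])).
  apply: bigcapT_measurable => q; apply: measurableC.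
  apply: countable_bigcupT_measurable => [|z]; first exact: countableP.
  apply: measurableC; rewrite -[X in measurable X]setTI.
  exact: (measurable_eval_at (grid q z) measurableT (measurable_set1 _)).
apply/seteqP; split=> [_ -> q _ [z _]|G GF] /=; first exact.
have eqF x : G x = F x.
  have Gq q z : G (grid q z) = F (grid q z).
    by apply: contrapT => GFz; apply: (GF q Logic.I); exists z.
  have := @objective_cvg_grid G x; under eq_fun do rewrite Gq.
  by move=> /(cvg_unique (@Rhausdorff R)); apply; exact: objective_cvg_grid.
case: F G {GF} eqF => [F pF] [G pG] /= /funext GF; subst G.
by congr Objective; exact: Prop_irrelevance.
Qed.

End ObjectiveMeasurability.

(** * The noise *)

Section NoiseLaw.
Context {R : realType}.
Variables (k : nat) (q : R).
Hypotheses (k_gt0 : (0 < k)%N) (q_gt0 : 0 < q) (q_le1 : q <= 1).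

(** The mean of f z when z is uniform on {0, ..., k-1} with total probability q,
    and equal to k otherwise. *)
Definition mean (f : nat -> R) : R := \sum_(i < k) q / k%:R * f i + (1 - q) * f k.

Lemma mean_cst c : mean (fun=> c) = c.
Proof.
rewrite /mean sumr_const card_ord -[X in X + _]mulr_natr.
by field; rewrite pnatr_eq0 -lt0n.
Qed.

Lemma exists_noise_law : exists P : probability nat R,
  forall f : nat -> R, (forall z, 0 <= f z) ->
  (\int[P]_z (f z)%:E = (mean f)%:E)%E.
Proof.
pose w (z : nat) : R := if (z < k)%N then q / k%:R else 1 - q.
have w0 z : 0 <= w z by rewrite /w; case: ifP => _; rewrite ?subr_ge0// divr_ge0// ltW.
pose mu_ (z : nat) : {measure set nat -> \bar R} := mscale (NngNum (w0 z)) \d_z.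
pose mu := msum mu_ k.+1.
have muE (f : nat -> R) : (forall z, 0 <= f z) -> (\int[mu]_z (f z)%:E = (mean f)%:E)%E.
  move=> f0; rewrite ge0_integral_measure_sum//; last by move=> z _; rewrite lee_fin.
  under eq_bigr => z _.
    rewrite ge0_integral_mscale//; last by move=> ? _; rewrite lee_fin.
    rewrite integral_dirac// diracT mul1e /= -EFinM; over.
  rewrite sumEFin big_ord_recr /= {2}/w ltnn /mean; congr (_ + _)%:E.
  by apply: eq_bigr => z _; rewrite /w ltn_ord.
have muT : mu setT = 1%E.
  by rewrite -[LHS]mul1e -integral_cst//= muE// mean_cst.
pose P : probability nat R := HB.pack mu (Measure_isProbability.Build _ _ _ mu muT).
by exists P.
Qed.

Lemma meanD f g : mean (fun z => f z + g z) = mean f + mean g.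
Proof.
rewrite /mean addrACA -mulrDr; congr (_ + _).
by rewrite -big_split; apply: eq_bigr => i _; rewrite mulrDr.
Qed.

Lemma meanZ c f : mean (fun z => c * f z) = c * mean f.
Proof.
rewrite /mean mulrDr mulr_sumr; congr (_ + _); last by rewrite mulrCA.
by apply: eq_bigr => i _; rewrite mulrCA.
Qed.

Lemma mean_sum (I : finType) (f : I -> nat -> R) :
  mean (fun z => \sum_i f i z) = \sum_i mean (f i).
Proof.
rewrite /mean big_split/= mulr_sumr; congr (_ + _).
by rewrite exchange_big/=; apply: eq_bigr => i _; rewrite mulr_sumr.
Qed.

Lemma mean_le f c c' : (forall z, (z < k)%N -> f z <= c) -> f k <= c' ->
  mean f <= q * c + (1 - q) * c'.
Proof.
move=> fc fc'; rewrite lerD//; last by rewrite ler_wpM2l// subr_ge0.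
rewrite (@le_trans _ _ (\sum_(i < k) q / k%:R * c))//.
  by apply: ler_sum => i _; rewrite ler_wpM2l ?fc// divr_ge0// ltW.
rewrite sumr_const card_ord -[leLHS]mulr_natr le_eqVlt; apply/orP; left.
by apply/eqP; field; rewrite pnatr_eq0 -lt0n.
Qed.

(** The noise factor of a coordinate of chain i: 0 with probability 1 - q/k,
    and k/q otherwise, minus the mean 1. *)
Definition reveal (i z : nat) : R := (z == i)%:R * (k%:R / q) - 1.

Lemma mean_reveal (i : 'I_k) : mean (reveal i) = 0.
Proof.
have k0 : k%:R != 0 :> R by rewrite pnatr_eq0 -lt0n.
have q0 : q != 0 by rewrite gt_eqF.
rewrite /reveal meanD mean_cst /mean gtn_eqF// mul0r mulr0 addr0.
rewrite (bigD1 i)//= eqxx big1 => [|j ji]; last by rewrite val_eqE (negPf ji) mul0r mulr0.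
by rewrite addr0 mul1r; field; rewrite k0 q0.
Qed.

Lemma sum_reveal_le z : \sum_(i < k) `|reveal i z| <= (z < k)%N%:R * (k%:R / q) + k%:R.
Proof.
have kq0 : 0 <= k%:R / q by rewrite divr_ge0// ltW.
apply: (@le_trans _ _ (\sum_(i < k) ((z == i)%:R * (k%:R / q) + 1))).
  apply: ler_sum => i _; rewrite /reveal (le_trans (ler_normB _ _))// normr1 lerD2r.
  by rewrite ger0_norm// mulr_ge0.
rewrite big_split/= sumr_const card_ord lerD2r -mulr_suml ler_wpM2r//.
case: ltnP => zk.
  by rewrite (bigD1 (Ordinal zk))//= eqxx big1 ?addr0// => j; rewrite -val_eqE eq_sym => /negPf ->.
by rewrite big1// => j _; rewrite gtn_eqF// (leq_trans (ltn_ord j)).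
Qed.

Variable P : probability nat R.
Hypothesis PE : forall f : nat -> R, (forall z, 0 <= f z) ->
  (\int[P]_z (f z)%:E = (mean f)%:E)%E.

Lemma noise_integrable (f : nat -> R) : P.-integrable setT (fun z => (f z)%:E).
Proof.
apply/integrableP; split=> //; under eq_integral do rewrite abse_EFin.
by rewrite PE ?ltry// => z; exact: normr_ge0.
Qed.

Lemma noise_integral (f : nat -> R) : (\int[P]_z (f z)%:E = (mean f)%:E)%E.
Proof.
pose fp z := Num.max (f z) 0; pose fn z := Num.max (- f z) 0.
have fE z : f z = fp z - fn z.
  by rewrite /fp /fn !maxEle; case: (leP (f z) 0); case: (leP (- f z) 0) => *; lra.
under eq_integral do rewrite fE EFinB.
rewrite integralB//; [|exact: noise_integrable|exact: noise_integrable].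
rewrite !PE; [|by move=> z; rewrite le_max lexx orbT|by move=> z; rewrite le_max lexx orbT].
rewrite -EFinB -[- mean fn]mulN1r -meanZ -meanD; congr (mean _)%:E.
by apply/funext => z; rewrite mulN1r -fE.
Qed.

End NoiseLaw.

(** * The oracle *)

Section HardOracle.
Local Open Scope classical_set_scope.
Local Open Scope ring_scope.
Context {R : realType} {k d m n : nat}.
Variables (e : 'I_k -> 'I_d -> 'I_m * 'I_n) (lam mu q p sigma : R).
Variables (Delta1 L : {posnum R}) (P : probability nat R).
Hypotheses (layout : chain_layout (R := R) e) (lam_gt0 : 0 < lam) (mu_ge0 : 0 <= mu).
Hypotheses (k_gt0 : (0 < k)%N) (q_gt0 : 0 < q) (q_le1 : q <= 1).
Hypothesis PE : forall f : nat -> R, (forall z, 0 <= f z) ->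
  (\int[P]_z (f z)%:E = (mean k q f)%:E)%E.
Hypothesis hardC : in_objective_class Delta1 L (hard e lam mu).
Local Notation M := 'M[R]_(m, n).
Local Notation obj := (objective m n Delta1 L).

Definition hard_objective : obj := Objective hardC.

Definition fresh (x : M) (i : 'I_k) (j : 'I_d) : bool :=
  [forall l : 'I_d, (j <= l)%N ==> (x (e i l).1 (e i l).2 == 0)].

Definition noise_array (x : M) (z : nat) : 'M[R]_(k, d) :=
  \matrix_(i, j) ((fresh x i j)%:R * chain_gradient e lam mu x i j * reveal k q i z).

(** Only for fresh variables is the partial derivative replaced by a noisy
    version. The noise does not depend on the objective: it is the one adapted
    to hard, and it is added to the exact gradient of every objective. *)
Definition noisy_gradient (F : obj) (x : M) (z : nat) : M :=
  gradient F x + embed e (noise_array x z).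

Lemma measurable_fresh i j : measurable_fun setT (fun x : M => fresh x i j).
Proof.
apply: (measurable_fun_bool true); rewrite setTI.
rewrite (_ : _ @^-1` _ = \bigcap_(l in [set l : 'I_d | (j <= l)%N])
  ((fun x : M => x (e i l).1 (e i l).2) @^-1` [set 0])).
  apply: fin_bigcap_measurable => [|l _]; first exact: finite_finset.
  rewrite -[X in measurable X]setTI.
  exact: (measurable_entry _ _ measurableT (measurable_set1 _)).
apply/seteqP; split=> x /=.
  by move=> /forallP fx l jl; apply/eqP; exact: (implyP (fx l) jl).
by move=> fx; apply/forallP => l; apply/implyP => jl; apply/eqP; exact: fx.
Qed.

Lemma measurable_chain_gradient i j :
  measurable_fun setT (fun x : M => chain_gradient e lam mu x i j).
Proof.
rewrite (_ : (fun _ => _) =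
    (fun x : M => gradient hard_objective x (e i j).1 (e i j).2)).
  have := measurable_fun_pair2 hard_objective (@measurable_gradient R m n Delta1 L).
  by move=> /(measurableT_comp (measurable_entry (e i j).1 (e i j).2)).
apply/funext => x; rewrite /= gradient_hard embedE//.
exact: layout_inj layout.
Qed.

Lemma measurable_noisy_gradient : measurable_fun setT
  (fun w : obj * (M * nat) => noisy_gradient w.1 w.2.1 w.2.2).
Proof.
apply: measurable_fun_mx => a b.
rewrite (_ : (fun _ => _) = (fun w : obj * (M * nat) => gradient w.1 w.2.1 a b +
  \sum_i \sum_j (e i j == (a, b))%:R * ((if fresh w.2.1 i j then 1 else 0) *
    chain_gradient e lam mu w.2.1 i j * reveal k q i w.2.2))); last first.
  apply/funext => w; rewrite /noisy_gradient mxE; congr (_ + _); rewrite mxE.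
  apply: eq_bigr => i _; apply: eq_bigr => j _; rewrite mxE.
  by case: fresh.
have mx : measurable_fun setT (fun w : obj * (M * nat) => w.2.1).
  exact: measurableT_comp measurable_fst measurable_snd.
have mz : measurable_fun setT (fun w : obj * (M * nat) => w.2.2).
  exact: measurableT_comp measurable_snd measurable_snd.
have mFx : measurable_fun setT (fun w : obj * (M * nat) => (w.1, w.2.1)).
  by apply: measurable_fun_pair mx.
apply: measurable_funD.
  exact: (measurableT_comp (measurable_entry a b)
    (measurableT_comp (@measurable_gradient R m n Delta1 L) mFx)).
apply: measurable_sum => i; apply: measurable_sum => j.
apply: measurable_funM => //; apply: measurable_funM; first apply: measurable_funM.
- apply: measurable_fun_ifT => //.
  exact: measurableT_comp (measurable_fresh i j) mx.
- exact: measurableT_comp (measurable_chain_gradient i j) mx.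
- have mr : measurable_fun (setT : set nat) (reveal k q i) by [].
  exact: measurableT_comp mr mz.
Qed.

Lemma noisy_gradient_integrable F x a b :
  P.-integrable setT (fun z => (noisy_gradient F x z a b)%:E).
Proof. exact: (noise_integrable PE (fun z => noisy_gradient F x z a b)). Qed.

Lemma noisy_gradient_unbiased F x a b :
  (\int[P]_z (noisy_gradient F x z a b)%:E = (gradient F x a b)%:E)%E.
Proof.
rewrite (noise_integral PE (fun z => noisy_gradient F x z a b)); congr (_%:E).
rewrite (_ : (fun _ => _) = (fun z => gradient F x a b +
  \sum_i \sum_j (e i j == (a, b))%:R * ((fresh x i j)%:R *
    chain_gradient e lam mu x i j) * reveal k q i z)); last first.
  apply/funext => z; rewrite /noisy_gradient mxE; congr (_ + _); rewrite mxE.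
  by apply: eq_bigr => i _; apply: eq_bigr => j _; rewrite mxE mulrA.
rewrite meanD mean_cst// mean_sum big1 ?addr0// => i _.
by rewrite mean_sum big1// => j _; rewrite meanZ mean_reveal// mulr0.
Qed.

Lemma sum_at_most_one (I : finType) (f : I -> R) c : 0 <= c ->
  (forall i, f i <= c) -> (forall i j, f i != 0 -> f j != 0 -> i = j) ->
  \sum_i f i <= c.
Proof.
move=> c0 fc f1; have [/existsP[i fi]|/existsPn f0] := boolP [exists i, f i != 0].
  rewrite (bigD1 i)//= big1 ?addr0// => j ji; apply/eqP.
  by apply: contraNT ji => fj; apply/eqP; exact: f1.
by rewrite big1// => i _; apply/eqP; have := f0 i; rewrite negbK.
Qed.

Lemma site_fresh (x : M) i j l : fresh x i j -> (j <= l)%N -> site e lam i l.+1 x = 0.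
Proof.
move=> /forallP fx jl; rewrite /site; case: insubP => // l' _ ll'.
by have := fx l'; rewrite ll' jl /= => /eqP ->; rewrite mul0r.
Qed.

(** By the zero-chain property a chain has at most one fresh variable with a
    nonzero partial derivative, namely the first one. *)
Lemma sum_fresh_le x i :
  \sum_j ((fresh x i j)%:R * chain_gradient e lam mu x i j) ^+ 2 <=
  (mu / lam * (3 / 2)) ^+ 2.
Proof.
have ml0 : 0 <= mu / lam by rewrite divr_ge0// ltW.
have nz j : ((fresh x i j)%:R * chain_gradient e lam mu x i j) ^+ 2 != 0 ->
    fresh x i j /\ site e lam i j x != 0.
  case: (boolP (fresh x i j)) => fx; last by rewrite mul0r expr0n/= eqxx.
  rewrite mul1r mxE => pn0; split=> //; apply: contra_neq pn0 => s0.
  by rewrite partial_zero ?mulr0 ?expr0n//; exact: site_fresh fx _.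
have lt j j' : fresh x i j -> site e lam i j' x != 0 -> (j' <= j)%N.
  move=> fx; rewrite leqNgt; apply: contra_neqN; case: (j' : nat) => // l jl.
  exact: site_fresh fx _.
apply: sum_at_most_one => [|j|j j' /nz[f1 s1] /nz[f2 s2]].
- exact: sqr_ge0.
- case: (boolP (fresh x i j)) => fx; last by rewrite mul0r expr0n sqr_ge0.
  rewrite mul1r mxE -[leLHS]real_normK ?num_real// ler_sqr ?nnegrE ?normr_ge0 ?(mulr_ge0 ml0)//.
  rewrite normrM ger0_norm// ler_wpM2l// partial_frontier//.
  exact: site_fresh fx _.
- by apply: ord_inj; apply/eqP; rewrite eqn_leq (lt _ _ f2 s1) (lt _ _ f1 s2).
Qed.

Lemma nuclear_norm_noise_le x z : nuclear_norm (embed e (noise_array x z)) <=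
  mu / lam * (3 / 2) * ((z < k)%N%:R * (k%:R / q) + k%:R).
Proof.
have ml0 : 0 <= mu / lam * (3 / 2) by rewrite mulr_ge0// divr_ge0// ltW.
rewrite (nuclear_norm_embed layout).
apply: le_trans (ler_wpM2l ml0 (sum_reveal_le k q_gt0 z)).
rewrite mulr_sumr; apply: ler_sum => i _.
rewrite -[leRHS](ger0_norm (mulr_ge0 ml0 (normr_ge0 _))) -sqrtr_sqr ler_wsqrtr//.
rewrite [leRHS]exprMn.
rewrite [`|_| ^+ 2]real_normK ?num_real//.
apply: le_trans (ler_wpM2r (sqr_ge0 _) (sum_fresh_le x i)).
by rewrite mulr_suml; apply: ler_sum => j _; rewrite mxE exprMn.
Qed.

Hypothesis p_ge1 : 1 <= p.
Hypothesis moment_le :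
  q * (3 * (mu / lam) * (k%:R / q)) `^ p + (3 / 2 * (mu / lam) * k%:R) `^ p <= sigma `^ p.

Lemma noisy_gradient_moment F x :
  (\int[P]_z (nuclear_norm (noisy_gradient F x z - gradient F x) `^ p)%:E <=
     (sigma `^ p)%:E)%E.
Proof.
rewrite (noise_integral PE (fun z => nuclear_norm (noisy_gradient F x z - gradient F x) `^ p)).
rewrite lee_fin; apply: le_trans moment_le.
have ml0 : 0 <= mu / lam by rewrite divr_ge0// ltW.
have p0 : 0 <= p by apply: le_trans p_ge1.
have powle a b : 0 <= a -> a <= b -> a `^ p <= b `^ p.
  by move=> a0 ab; rewrite ge0_ler_powR// nnegrE// (le_trans a0).
have kq0 : 0 <= k%:R / q by rewrite divr_ge0// ltW.
have kkq : k%:R <= k%:R / q by rewrite ler_pdivlMr// ler_piMr.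
apply: le_trans (mean_le k_gt0 q_gt0 q_le1 (c := (3 * (mu / lam) * (k%:R / q)) `^ p)
  (c' := (3 / 2 * (mu / lam) * k%:R) `^ p) _ _) _.
- move=> z zk; rewrite /noisy_gradient addrC addKr; apply: powle (nuclear_norm_ge0 _) _.
  by apply: le_trans (nuclear_norm_noise_le x z) _; rewrite zk /= mul1r; nra.
- rewrite /noisy_gradient addrC addKr; apply: powle (nuclear_norm_ge0 _) _.
  by apply: le_trans (nuclear_norm_noise_le x k) _; rewrite ltnn /= mul0r add0r; lra.
- by rewrite lerD2l ler_piMl ?powR_ge0// lerBlDr lerDl ltW.
Qed.

Definition hard_oracle : oracle m n Delta1 L p sigma :=
  Oracle measurable_noisy_gradient noisy_gradient_integrable
    noisy_gradient_unbiased noisy_gradient_moment.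

End HardOracle.

(** * Successful draws and progress *)

Section Sampling.
Local Open Scope classical_set_scope.
Local Open Scope ring_scope.
Context {R : realType} {k : nat} {q : R}.
Variables (P : probability nat R).
Hypotheses (k_gt0 : (0 < k)%N) (q_gt0 : 0 < q).
Hypothesis PE : forall f : nat -> R, (forall z, 0 <= f z) ->
  (\int[P]_z (f z)%:E = (mean k q f)%:E)%E.

(** The number of draws that reveal a derivative of some chain. *)
Definition reveals (xs : seq nat) : nat := count (fun z => (z < k)%N) xs.

Lemma measurable_reveals t :
  measurable_fun setT (fun xs : t.-tuple nat => (reveals xs)%:R : R).
Proof.
rewrite (_ : (fun _ => _) = (fun xs : t.-tuple nat =>
    \sum_(i < t) (tnth xs i < k)%N%:R)); last first.
  apply/funext => xs; rewrite /reveals -sum1_count big_mkcond big_tuple natr_sum.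
  by apply: eq_bigr => i _; case: ifP.
apply: measurable_sum => i.
have mk : measurable_fun (setT : set nat) (fun z : nat => (z < k)%N%:R : R) by [].
exact: measurableT_comp mk (measurable_tnth i).
Qed.

Lemma mean_reveals t :
  (\int[iid_law P t]_xs ((reveals xs)%:R)%:E = (t%:R * q)%:E)%E.
Proof.
elim: t => [|t IH] /=.
  rewrite integral_dirac//; first by rewrite diracT mul1e mul0r.
  by apply/measurable_EFinP; exact: measurable_reveals.
have m1 : measurable_fun (setT : set nat) (fun z : nat => (z < k)%N%:R : R) by [].
have cstI (c : R) : (\int[iid_law P t]_xs c%:E = c%:E)%E.
  transitivity (c%:E * iid_law P t setT)%E; first exact: integral_cst.
  have -> : iid_law P t setT = 1%E by exact: probability_setT.
  by rewrite mule1.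
rewrite ge0_integral_distribution//; last 1 first.
- by apply/measurable_EFinP; exact: measurable_reveals.
rewrite fubini_tonelli1//=; last 1 first.
- apply/measurable_EFinP.
  exact: (measurableT_comp (@measurable_reveals t.+1) (@measurable_cons_pair _ nat t)).
rewrite /fubini_F /=.
under eq_integral => z _.
  rewrite (eq_integral (fun xs : t.-tuple nat => ((z < k)%N%:R)%:E + ((reveals xs)%:R)%:E)%E); last first.
    by move=> xs _; rewrite /reveals /= natrD EFinD.
  rewrite ge0_integralD//; last 1 first.
  - by apply/measurable_EFinP; exact: measurable_reveals.
  rewrite IH cstI -EFinD.
  over.
rewrite PE => [|z]; last by rewrite addr_ge0// mulr_ge0// ltW.
rewrite meanD mean_cst// /mean ltnn mulr0 addr0.
rewrite (eq_bigr (fun=> q / k%:R)) => [|i _]; last by rewrite ltn_ord mulr1.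
rewrite sumr_const card_ord -[X in X + _]mulr_natr divfK ?pnatr_eq0 -?lt0n//.
by rewrite -[t.+1%:R]natr1 mulrDl mul1r addrC.
Qed.

Lemma measurable_few_reveals t d :
  measurable [set xs : t.-tuple nat | (2 * reveals xs <= k * d)%N].
Proof.
rewrite (_ : mkset _ = (fun xs : t.-tuple nat => (reveals xs)%:R : R) @^-1`
    `]-oo, (k * d)%:R / 2]).
  by rewrite -[X in measurable X]setTI; exact: measurable_reveals.
by apply/seteqP; split=> xs; rewrite /= in_itv/= ler_pdivlMr// -natrM ler_nat mulnC.
Qed.

(** Markov's inequality for the number of successful draws, of mean t q. *)
Lemma few_reveals t d : (0 < d)%N ->
  ((1 - 2 * (t%:R * q) / (k * d)%:R)%:E <=
   iid_law P t [set xs : t.-tuple nat | (2 * reveals xs <= k * d)%N])%E.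
Proof.
move=> d_gt0; set E := [set xs : t.-tuple nat | _].
have kd0 : 0 < (k * d)%:R :> R by rewrite ltr0n muln_gt0 k_gt0.
have mE : measurable E by exact: measurable_few_reveals.
have mEC : measurable (~` E) by exact: measurableC.
suff : (iid_law P t (~` E) <= (2 * (t%:R * q) / (k * d)%:R)%:E)%E.
  rewrite probability_setC// => h.
  have fE : iid_law P t E \is a fin_num by exact: fin_num_measure.
  by rewrite EFinB leeBlDr// -leeBlDl.
have -> : iid_law P t (~` E) = (\int[iid_law P t]_xs (\1_(~` E) xs)%:E)%E.
  by rewrite integral_indic// setIT.
apply: (@le_trans _ _ (\int[iid_law P t]_xs ((2 / (k * d)%:R)%:E * ((reveals xs)%:R)%:E))%E).
  apply: ge0_le_integral => //.
  - by apply/measurable_EFinP; exact: measurable_indic.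
  - apply/measurable_EFinP; apply: measurable_funM => //; exact: measurable_reveals.
  - move=> xs _; rewrite -EFinM lee_fin indicE.
    case: (boolP (xs \in _)) => [|_]; last by rewrite mulr_ge0// divr_ge0.
    rewrite inE /E /= => /negP; rewrite -ltnNge => /ltnW h.
    by rewrite mulrAC ler_pdivlMr// mul1r -natrM ler_nat.
rewrite ge0_integralZl_EFin//.
- by rewrite mean_reveals -EFinM lee_fin mulrAC.
- by apply/measurable_EFinP; exact: measurable_reveals.
Qed.

End Sampling.

Section Run.
Local Open Scope classical_set_scope.
Local Open Scope ring_scope.
Context {R : realType} {k d m n : nat}.
Variables (e : 'I_k -> 'I_d -> 'I_m * 'I_n) (lam mu q : R).
Variables (Delta1 L : {posnum R}) (A : algorithm R m n).
Hypothesis layout : chain_layout (R := R) e.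
Hypothesis hardC : in_objective_class Delta1 L (hard e lam mu).
Hypothesis zrA : zero_respecting A.
Local Notation M := 'M[R]_(m, n).
Implicit Types (r : seed_space A) (xs : seq nat).

Lemma next_iterate_zero r (gs : seq M) ij :
  (forall g, g \in gs -> g ij.1 ij.2 = 0) -> next_iterate r gs ij.1 ij.2 = 0.
Proof.
have [zr0 zr] := zrA; case: gs => [|g gs] gs0; first by rewrite zr0 mxE.
have /fintype.subsetP sub := zr r (g :: gs) isT.
apply/eqP; apply: contraT => xij.
have : ij \in mxsupp (next_iterate r (g :: gs)) by rewrite inE.
move=> /sub; rewrite big_tnth => /finset.bigcupP[i _]; rewrite inE.
by rewrite gs0 ?eqxx// mem_tnth.
Qed.

(** A chain whose variables vanish from index c on is not extended unless its
    own number is drawn, and then by one variable only: the first variable is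
    hidden by the noise, the later ones by the zero-chain property. *)
Lemma noisy_gradient_zero (x : M) (z : nat) (i : 'I_k) (j : 'I_d) (c : nat) :
  (forall l : 'I_d, (c <= l)%N -> x (e i l).1 (e i l).2 = 0) -> (c + (z == i :> nat) <= j)%N ->
  noisy_gradient e lam mu q (hard_objective hardC) x z (e i j).1 (e i j).2 = 0.
Proof.
move=> x0; rewrite /noisy_gradient mxE /= gradient_hard !(embedE _ _ _ (layout_inj layout)).
rewrite [noise_array _ _ _ _ _ _ _ _]mxE; case: eqVneq => [zi|zi] cj.
  suff -> : chain_gradient e lam mu x i j = 0 by rewrite mulr0 mul0r addr0.
  have site0 l : (c <= l)%N -> site e lam i l.+1 x = 0.
    by move=> cl; rewrite /site; case: insubP => // l' _ ll'; rewrite x0 ?ll'// mul0r.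
  rewrite mxE partial_zero ?mulr0//; last by rewrite site0// (leq_trans _ cj)// leq_addr.
  by case: (j : nat) cj => [|l]; rewrite addn1// ltnS; exact: site0.
have fx : fresh e x i j.
  apply/forallP => l; apply/implyP => jl; rewrite x0//.
  by rewrite (leq_trans _ jl)// (leq_trans _ cj)// leq_addr.
by rewrite fx mul1r /reveal (negPf zi) mul0r sub0r mulrN1 subrr.
Qed.

Definition run r xs : seq M :=
  foldl (fun gs z => rcons gs
    (noisy_gradient e lam mu q (hard_objective hardC) (next_iterate r gs) z)) [::] xs.

(** Whatever the algorithm does, chain i makes no more progress than there are
    draws of its number. *)
Lemma run_zero r xs (g : M) (i : 'I_k) (j : 'I_d) : g \in run r xs ->
  (count_mem (i : nat) xs <= j)%N -> g (e i j).1 (e i j).2 = 0.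
Proof.
elim/last_ind: xs g j => [//|xs z IH] g j; rewrite /run foldl_rcons mem_rcons inE.
rewrite -cats1 count_cat /= addn0 => /predU1P[->|gx] cj; last first.
  by apply: IH gx _; rewrite (leq_trans _ cj)// leq_addr.
apply: noisy_gradient_zero cj => l cl; apply: next_iterate_zero => h hx.
exact: IH hx cl.
Qed.

Lemma iterate_site_zero r xs (i : 'I_k) : (0 < d)%N -> (count_mem (i : nat) xs < d)%N ->
  site e lam i d (next_iterate r (run r xs)) = 0.
Proof.
move=> d0 cd; have d1 : (d.-1 < d)%N by rewrite prednK.
rewrite -[X in site _ _ _ X _](prednK d0) (site_ord e lam i (Ordinal d1)).
rewrite next_iterate_zero ?mul0r// => g gx.
by apply: run_zero gx _; rewrite /= -ltnS prednK.
Qed.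

Lemma sum_count_mem xs : (\sum_(i < k) count_mem (i : nat) xs = reveals (k := k) xs)%N.
Proof.
elim: xs => [|z xs IH]; first by rewrite big1.
rewrite /reveals /= -/(reveals xs) -IH big_split/=; congr addn.
case: ltnP => zk.
  by rewrite (bigD1 (Ordinal zk))//= eqxx big1// => j; rewrite -val_eqE eq_sym => /negPf ->.
by rewrite big1// => j _; rewrite gtn_eqF// (leq_trans (ltn_ord j)).
Qed.

(** Finishing a chain takes d draws of its number, so that at most half of the
    chains are finished after k d / 2 draws. *)
Lemma card_unfinished_ge r xs : (0 < d)%N -> (2 * reveals (k := k) xs <= k * d)%N ->
  (k <= 2 * #|[set i | site e lam i d (next_iterate r (run r xs)) == 0%R]%SET|)%N.
Proof.
move=> d0 few; set U := [set i | _]%SET.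
have : (d * #|~: U| <= reveals (k := k) xs)%N.
  rewrite -sum_count_mem mulnC -sum_nat_const.
  rewrite [leqRHS](bigID (fun i => i \in ~: U))/= (leq_trans _ (leq_addr _ _))//.
  apply: leq_sum => i; rewrite !inE leqNgt; apply: contra => cd.
  by rewrite iterate_site_zero.
have := cardsC U; rewrite card_ord => kE h.
have {few h} : (2 * (d * #|~: U|) <= k * d)%N by rewrite (leq_trans _ few)// leq_mul2l h orbT.
rewrite mulnCA [(k * d)%N]mulnC leq_pmul2l// => h.
by move: #|U| #|~: U| kE h => a b; lia.
Qed.

End Run.

(** * The lower bound *)

Lemma le_integral_below {R : realType} (disp : measure_display) (T : measurableType disp)
    (mu : {measure set T -> \bar R}) (f g : T -> \bar R) :
  (forall x, 0 <= f x)%E -> (forall x, f x <= g x)%E ->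
  (\int[mu]_x f x <= \int[mu]_x g x)%E.
Proof.
move=> f0 fg; have g0 x : (0 <= g x)%E by apply: le_trans (fg x).
rewrite !ge0_integralTE//; apply: ereal_sup_le => _ [h hf <-].
by exists h => // x; apply: le_trans (fg x).
Qed.

(** For a function of unknown measurability, such as the gradient norm along a
    run: the integral of a nonnegative function is a supremum over the simple
    functions below it. *)
Lemma mul_measure_le_integral {R : realType} disp (T : measurableType disp)
    (mu : {measure set T -> \bar R}) (B : set T) (c : R) (f : T -> R) :
  measurable B -> 0 <= c -> (forall w, 0 <= f w) -> (forall w, B w -> c <= f w) ->
  (c%:E * mu B <= \int[mu]_w (f w)%:E)%E.
Proof.
move=> mB c0 f0 cf.
apply: (@le_trans _ _ (\int[mu]_w (c%:E * (\1_B w)%:E))%E).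
  rewrite ge0_integralZl_EFin//; last by apply/measurable_EFinP; exact: measurable_indic.
  by rewrite integral_indic// setIT.
apply: le_integral_below => w; first by rewrite -EFinM lee_fin mulr_ge0.
rewrite -EFinM lee_fin indicE; case: (boolP (_ \in _)) => [|_]; last by rewrite mulr0.
by rewrite inE => Bw; rewrite mulr1; exact: cf.
Qed.

Lemma integral_rectangle_ge {R : realType} d1 d2 d3 (T1 : measurableType d1)
    (T2 : measurableType d2) (T3 : measurableType d3) (P1 : probability T1 R)
    (P2 : probability T2 R) (P3 : probability T3 R) (A1 : set T1) (A2 : set T2)
    (A3 : set T3) (c : R) (f : T1 * (T2 * T3) -> R) :
  measurable A1 -> measurable A2 -> measurable A3 ->
  0 <= c -> (forall w, 0 <= f w) ->
  (forall x y z, A1 x -> A2 y -> A3 z -> c <= f (x, (y, z))) ->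
  (c%:E * (P1 A1 * (P2 A2 * P3 A3)) <= \int[P1 \x (P2 \x P3)]_w (f w)%:E)%E.
Proof.
move=> mA1 mA2 mA3 c0 f0 cf.
pose P23 : probability _ R := (P2 \x P3)%E; pose P123 : probability _ R := (P1 \x P23)%E.
pose B := (A1 `*` (A2 `*` A3))%classic.
have mA23 : measurable (A2 `*` A3)%classic by exact: measurableX.
have mB : measurable B by exact: measurableX.
have -> : (P1 A1 * (P2 A2 * P3 A3) = P123 B)%E.
  have <- : (P23 (A2 `*` A3)%classic = P2 A2 * P3 A3)%E by exact: product_measure1E.
  by symmetry; exact: product_measure1E.
apply: (@mul_measure_le_integral _ _ _ P123 B c f) => // -[x [y z]] [/= Ax [Ay Az]].
exact: cf.
Qed.

Section ExpectedGradientNorm.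
Local Open Scope classical_set_scope.
Local Open Scope ring_scope.
Context {R : realType} {k d m n : nat}.
Variables (e : 'I_k -> 'I_d -> 'I_m * 'I_n) (lam mu q p sigma : R).
Variables (Delta1 L : {posnum R}) (P : probability nat R).
Hypotheses (layout : chain_layout (R := R) e) (lam_gt0 : 0 < lam) (mu_ge0 : 0 <= mu).
Hypotheses (k_gt0 : (0 < k)%N) (q_gt0 : 0 < q) (q_le1 : q <= 1).
Hypothesis PE : forall f : nat -> R, (forall z, 0 <= f z) ->
  (\int[P]_z (f z)%:E = (mean k q f)%:E)%E.
Hypothesis hardC : in_objective_class Delta1 L (hard e lam mu).
Hypothesis p_ge1 : 1 <= p.
Hypothesis moment_le :
  q * (3 * (mu / lam) * (k%:R / q)) `^ p + (3 / 2 * (mu / lam) * k%:R) `^ p <= sigma `^ p.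
Variable A : algorithm R m n.
Hypotheses (zrA : zero_respecting A) (d_gt0 : (0 < d)%N).
Local Notation O := (hard_oracle layout lam_gt0 mu_ge0 k_gt0 q_gt0 q_le1 PE hardC p_ge1 moment_le).

(** As long as few draws have been successful, at least half of the chains are
    unfinished, and each of them contributes mu / lam to the nuclear norm. *)
Lemma expected_gradient_norm_ge t :
  ((mu / lam * k%:R / 2 * (1 - 2 * (t%:R * q) / (k * d)%:R))%:E <=
   expected_gradient_norm O A \d_(hard_objective hardC : objective m n Delta1 L) t)%E.
Proof.
have ml0 : 0 <= mu / lam by rewrite divr_ge0// ltW.
set c := mu / lam * k%:R / 2.
have c0 : 0 <= c by rewrite /c divr_ge0// mulr_ge0.
pose E := [set xs : t.-tuple nat | (2 * reveals (k := k) xs <= k * d)%N].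
have mE : measurable E by exact: measurable_few_reveals.
pose F0 : objective m n Delta1 L := hard_objective hardC.
have mF0 : measurable [set F0] by exact: measurable_set1_objective.
apply: (@le_trans _ _ (c%:E * (\d_F0 [set F0] * (seed_law A setT * iid_law P t E)))%E).
  rewrite probability_setT mul1e diracE mem_set// mul1e EFinM lee_wpmul2l ?lee_fin//.
  exact: few_reveals.
apply: integral_rectangle_ge => // [w|_ r xs -> _ Exs]; first exact: nuclear_norm_ge0.
apply: le_trans (gradient_hard_ge layout lam_gt0 mu_ge0 _ d_gt0).
rewrite /c -mulrA ler_wpM2l// ler_pdivrMr// -natrM ler_nat mulnC.
exact: (card_unfinished_ge q layout hardC zrA r d_gt0 Exs).
Qed.

End ExpectedGradientNorm.

Theorem mainTheorem5 (R : realType) (Delta1 L : {posnum R}) (sigma p eps : R) :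
  let c : R := 1 / 300 in
  0 < sigma -> 1 < p <= 2 ->
  0 < eps <= c * Num.min sigma (Num.sqrt (Delta1%:num * L%:num)) ->
  forall m n : nat, (2 <= m)%N -> (2 <= n)%N ->
  (minn m n)%:R * (Delta1%:num * L%:num / eps ^+ 2) <= (maxn m n)%:R :> R ->
  ((c ^+ 2 * (minn m n)%:R * (Delta1%:num * L%:num / eps ^+ 2) *
      (c * sigma / eps) `^ (p / (p - 1)))%:E
   <= zr_complexity m n eps Delta1 L p sigma)%E.
Proof.
move=> c sigma_gt0 /andP[p_gt1 p_le2] /andP[eps_gt0 eps_le] m n m2 n2 mn_le.
have cE : c = 1 / 300 by []; clearbody c.
have c0 : 0 < c by rewrite cE; lra.
have [eps_sigma eps_DL] : eps <= c * sigma /\ eps <= c * Num.sqrt (Delta1%:num * L%:num).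
  by split; apply: (le_trans eps_le); rewrite ler_wpM2l ?(ltW c0)// ge_min lexx ?orbT.
have L0 : 0 < L%:num by [].
set k := minn m n in mn_le *; set a := Delta1%:num * L%:num / eps ^+ 2 in mn_le *.
set Q := (c * sigma / eps) `^ (p / (p - 1)).
have k_gt0 : (0 < k)%N by rewrite /k leq_min !(leq_trans _ m2, leq_trans _ n2).
have kR0 : 0 < k%:R :> R by rewrite ltr0n.
have a_ge : 300 * 300 <= a.
  rewrite /a ler_pdivlMr ?exprn_gt0//.
  have : eps ^+ 2 <= (c * Num.sqrt (Delta1%:num * L%:num)) ^+ 2.
    by rewrite ler_sqr ?nnegrE ?mulr_ge0 ?sqrtr_ge0 ?(ltW c0) ?(ltW eps_gt0).
  by rewrite exprMn sqr_sqrtr ?mulr_ge0// cE; lra.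
have x_ge1 : 1 <= c * sigma / eps by rewrite ler_pdivlMr// mul1r.
have pp0 : 0 <= p / (p - 1) by rewrite divr_ge0// ?subr_ge0; lra.
have Q_ge1 : 1 <= Q.
  have <- : 1 `^ (p / (p - 1)) = 1 :> R by rewrite powR1.
  by rewrite ge0_ler_powR ?nnegrE ?ler01 ?(le_trans ler01 x_ge1).
have Q_gt0 : 0 < Q by apply: lt_le_trans Q_ge1.
(* The success probability for which the p-th moment of the noise is of order
   sigma ^ p. *)
pose q := Q^-1.
have q_gt0 : 0 < q by rewrite invr_gt0.
have q_le1 : q <= 1 by rewrite invf_le1.
(* A chain is a sum of d + 1 links, hence the predecessor. Each link is at least
   - 4, and 72 * 72 = 4 * 4 * 4 * 81 keeps the scaled chain above - Delta1 / k. *)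
pose d := (Num.truncn (a / (72 * 72))).-1.
have a5 : 0 <= a / (72 * 72) by lra.
have [d_gt0 d1_le d_ge] : [/\ (0 < d)%N, d.+1%:R <= a / (72 * 72) & a / (150 * 150) <= d%:R].
  have /andP[t1 t2] := truncn_itv a5.
  have tge : (17 <= Num.truncn (a / (72 * 72)))%N by rewrite truncn_ge_nat//; lra.
  have dE : d.+1 = Num.truncn (a / (72 * 72)) by rewrite prednK// (leq_trans _ tge).
  have d1 : d.+1%:R <= a / (72 * 72) by rewrite dE.
  split=> //; first by rewrite -ltnS dE (leq_trans _ tge).
  by move: t2 a_ge; rewrite -dE -[d.+2%:R]natr1 -[d.+1%:R]natr1; lra.
have kd_le : (k * d <= maxn m n)%N.
  rewrite -(ler_nat R) natrM (le_trans _ mn_le)// ler_wpM2l//.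
  by move: d1_le; rewrite -[d.+1%:R]natr1; lra.
have [e layout] := exists_chain_layout (R := R) kd_le.
(* lam makes hard L-smooth (18 * 18 = 4 * 81), and mu / lam = 4 eps / k leaves a
   gradient norm of 2 eps when half of the chains are unfinished. *)
pose lam := 18 * 18 * eps / L%:num; pose mu := 4 * eps / k%:R * lam.
have lam_gt0 : 0 < lam by rewrite divr_gt0// mulr_gt0.
have mu_ge0 : 0 <= mu by rewrite mulr_ge0 ?divr_ge0 ?mulr_ge0// ltW.
have ml : mu / lam = 4 * eps / k%:R by rewrite /mu mulfK// gt_eqF.
have hardC : in_objective_class Delta1 L (hard e lam mu).
  apply: hard_in_class => //.
  - rewrite le_eqVlt; apply/orP; left; apply/eqP.
    rewrite /mu /lam; field.
    by rewrite !gt_eqF.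
  - have -> : mu * (k * d.+1 * 4)%:R = 72 * 72 * eps ^+ 2 / L%:num * d.+1%:R.
      by rewrite !natrM /mu /lam; field; rewrite !gt_eqF.
    rewrite -ler_pdivlMl ?divr_gt0 ?mulr_gt0 ?exprn_gt0//.
    apply: le_trans d1_le _; rewrite le_eqVlt; apply/orP; left; apply/eqP.
    by rewrite /a; field; rewrite !gt_eqF.
have moment_le : q * (3 * (mu / lam) * (k%:R / q)) `^ p +
    (3 / 2 * (mu / lam) * k%:R) `^ p <= sigma `^ p.
  rewrite ml.
  have small s : 0 < s <= 1 -> (s * sigma) `^ p <= s * sigma `^ p.
    move=> /andP[s0 s1]; rewrite powRM ?(ltW s0) ?(ltW sigma_gt0)// ler_wpM2r ?powR_ge0//.
    by rewrite -[leRHS]powRr1 ?(ltW s0)// ger_powR ?s0// ltW.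
  have -> : q * (3 * (4 * eps / k%:R) * (k%:R / q)) `^ p = (25^-1 * sigma) `^ p.
    have -> : 3 * (4 * eps / k%:R) * (k%:R / q) = 12 * eps * Q.
      by rewrite /q invrK; field; rewrite gt_eqF.
    have -> : 25^-1 * sigma = 12 * eps * (c * sigma / eps).
      by rewrite cE; field; rewrite gt_eqF.
    rewrite powRM ?mulr_ge0 ?(ltW eps_gt0) ?(ltW Q_gt0)//.
    rewrite [in RHS]powRM; [|by rewrite mulr_ge0// ltW|exact: le_trans ler01 x_ge1].
    rewrite mulrCA; congr (_ * _); rewrite /q /Q -powRrM -powRN -powRD; last first.
      by apply/implyP => _; rewrite gt_eqF// (lt_le_trans _ x_ge1).
    by congr (_ `^ _); field; rewrite subr_eq0 gt_eqF.
  have -> : 3 / 2 * (4 * eps / k%:R) * k%:R = 6 * eps by field; rewrite gt_eqF.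
  have : (6 * eps) `^ p <= (50^-1 * sigma) `^ p.
    rewrite ge0_ler_powR ?nnegrE//; [lra|lra|lra|].
    by move: eps_sigma; rewrite cE; lra.
  have s25 : (25^-1 * sigma) `^ p <= 25^-1 * sigma `^ p by apply: small; lra.
  have s50 : (50^-1 * sigma) `^ p <= 50^-1 * sigma `^ p by apply: small; lra.
  by have := powR_ge0 sigma p; lra.
have [P PE] := exists_noise_law k_gt0 q_gt0 q_le1.
pose O := hard_oracle layout lam_gt0 mu_ge0 k_gt0 q_gt0 q_le1 PE hardC (ltW p_gt1) moment_le.
apply: ereal_sup_ge; eexists; first by exists O; reflexivity.
apply: ereal_sup_ge; eexists.
  by exists (\d_(hard_objective hardC : objective m n Delta1 L)); reflexivity.
apply: le_ereal_inf_tmp => _ [A [zrA ->]].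
apply: le_ereal_inf_tmp => _ [t /= Et <-]; rewrite lee_fin.
have := le_trans (expected_gradient_norm_ge layout lam_gt0 mu_ge0 k_gt0 q_gt0 q_le1
  PE hardC (ltW p_gt1) moment_le zrA d_gt0 t) Et.
rewrite lee_fin ml natrM {O Et}.
have dR0 : 0 < d%:R :> R by rewrite ltr0n.
have -> : 4 * eps / k%:R * k%:R / 2 * (1 - 2 * (t%:R * q) / (k%:R * d%:R)) =
    2 * eps - 4 * eps * (t%:R / (k%:R * d%:R * Q)).
  by rewrite /q; field; rewrite !gt_eqF.
move=> le_eps; have t_ge : k%:R * d%:R * Q <= 4 * t%:R.
  have kdQ : 0 < k%:R * d%:R * Q by rewrite !mulr_gt0.
  rewrite -[leLHS]mul1r -ler_pdivlMr// -[leRHS]mulrA -(ler_pM2l eps_gt0).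
  by move: le_eps; set X := t%:R / _; lra.
rewrite -[t.+1%:R]natr1; apply: (@le_trans _ _ t%:R); last by lra.
have : k%:R * (a / (150 * 150)) * Q <= k%:R * d%:R * Q by rewrite ler_pM2r// ler_pM2l.
by rewrite cE; move: t_ge; lra.
Qed.
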